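(* Let $V\subseteq\mathcal V$ be finite and $\mathbb E,\mathbb F\in\mathit{NProg}(V)$. Then: (1) $\mathbb E\le_T^s\mathbb F$ iff $\mathbb E\le_S\mathbb F$ iff ${\uparrow}\mathbb F\subseteq{\uparrow}\mathbb E$; (2) $\mathbb E\le_P^s\mathbb F$ iff $\mathbb F\le_H\mathbb E$ iff ${\downarrow}\mathbb F\subseteq{\downarrow}\mathbb E$; (3) $\mathbb E\le_{EM}\mathbb F$ iff both $\mathbb E\le_T^s\mathbb F$ and $\mathbb F\le_P^s\mathbb E$; (4) $\mathbb E\equiv_T^s\mathbb F$ iff ${\uparrow}\mathbb E={\uparrow}\mathbb F$, and $\mathbb E\equiv_P^s\mathbb F$ iff ${\downarrow}\mathbb E={\downarrow}\mathbb F$; (5) if $\mathbb E$ and $\mathbb F$ contain only trace-preserving super-operators, then $\mathbb E\le_T^s\mathbb F$ iff $\mathbb E\le_P^s\mathbb F$ iff $\mathbb F\subseteq\mathbb E$.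
   Context: $\mathcal V$ is a countably infinite set of quantum variables, each with state space $\mathbb C^2$; for finite $V$, $\mathcal H_V=\bigotimes_{q\in V}\mathcal H_q$. $\mathcal D(\mathcal H)$: partial density operators (positive, trace $\le1$); $\mathcal P(\mathcal H)$: effects (positive operators with eigenvalues in $[0,1]$); $\sqsubseteq$: Löwner order. $\mathit{DProg}(V)$: completely positive trace-nonincreasing (CPTN) super-operators on $\mathcal L(\mathcal H_V)$, ordered by $\mathcal E\sqsubseteq\mathcal F$ iff $\mathcal F-\mathcal E$ is completely positive. $\mathit{NProg}(V)$ is the set of nonempty, convex, closed subsets of $\mathit{DProg}(V)$. Operators/super-operators on subsystems are implicitly extended by tensoring with identities. For $\mathbb E\in\mathit{NProg}(V)$ and a state $\rho$, $\mathbb E(\rho)=\{\mathcal E(\rho):\mathcal E\in\mathbb E\}$. Orders on subsets of $\mathit{DProg}(V)$: $\mathbb E\le_S\mathbb F$ iff $\forall\mathcal F\in\mathbb F\,\exists\mathcal E\in\mathbb E:\mathcal E\sqsubseteq\mathcal F$ (Smyth); $\mathbb E\le_H\mathbb F$ iff $\forall\mathcal E\in\mathbb E\,\exists\mathcal F\in\mathbb F:\mathcal E\sqsubseteq\mathcal F$ (Hoare); $\le_{EM}$ is the conjunction of $\le_H$ and $\le_S$ (Egli–Milner). ${\uparrow}\mathbb E=\{\mathcal F\in\mathit{DProg}(V):\exists\mathcal E\in\mathbb E,\ \mathcal E\sqsubseteq\mathcal F\}$ and ${\downarrow}\mathbb E=\{\mathcal F\in\mathit{DProg}(V):\exists\mathcal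 E\in\mathbb E,\ \mathcal F\sqsubseteq\mathcal E\}$. For $\Theta\subseteq\mathcal P(\mathcal H_W)$ and a state $\rho$, $\mathrm{Exp}_{dem}(\rho\models\Theta)=\inf_{M\in\Theta}{\rm tr}(M\rho)$, with the infimum over $\emptyset$ equal to ${\rm tr}(\rho)$. For finite $W$ and $\Theta,\Psi\subseteq\mathcal P(\mathcal H_W)$: $\mathbb E\models_{tot}(\Theta,\Psi)$ iff for every finite $X\supseteq V\cup W$ and $\rho\in\mathcal D(\mathcal H_X)$, $\mathrm{Exp}_{dem}(\rho\models\Theta)\le\inf\{\mathrm{Exp}_{dem}(\sigma\models\Psi):\sigma\in\mathbb E(\rho)\}$; $\mathbb E\models_{par}(\Theta,\Psi)$ iff for all such $X,\rho$, $\mathrm{Exp}_{dem}(\rho\models\Theta)\le\inf\{\mathrm{Exp}_{dem}(\sigma\models\Psi)+{\rm tr}(\rho)-{\rm tr}(\sigma):\sigma\in\mathbb E(\rho)\}$. $\mathbb E\le_T^s\mathbb F$ iff for every finite $W$ and all $\Theta,\Psi\subseteq\mathcal P(\mathcal H_W)$, $\mathbb E\models_{tot}(\Theta,\Psi)$ implies $\mathbb F\models_{tot}(\Theta,\Psi)$; $\le_P^s$ likewise with $\models_{par}$; $\equiv_T^s,\equiv_P^s$ are the corresponding kernels (refinement in both directions). *)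

(* Defs.v *)
From HB Require Import structures.
From mathcomp Require Import all_boot all_order all_algebra.
From mathcomp Require Import finmap.
From mathcomp Require Import complex.
From mathcomp Require Import boolp classical_sets reals topology normedtype sequences.

Set Implicit Arguments.
Unset Strict Implicit.
Unset Printing Implicit Defensive.

Import Order.TTheory GRing.Theory Num.Theory.
Import numFieldNormedType.Exports.
Local Open Scope ring_scope.
Local Open Scope classical_set_scope.

Section QDefs.
Variable R : realType.
Local Notation C := R[i].

(* ---------- operators and super-operators on a Hilbert space with ONB I ---------- *)
Definition Op (I : finType) := I -> I -> C.
Definition SuperOp (I : finType) := Op I -> Op I.

Definition op_trace (I : finType) (A : Op I) : C := \sum_(i : I) A i i.
Definition op_mul (I : finType) (A B : Op I) : Op I :=
  fun i j => \sum_(k : I) A i k * B k j.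
Definition op_id (I : finType) : Op I := fun i j => if i == j then 1 else 0.
Definition op_sub (I : finType) (A B : Op I) : Op I := fun i j => A i j - B i j.

Definition psd (I : finType) (A : Op I) : Prop :=
  forall psi : I -> C, 0 <= \sum_(i : I) \sum_(j : I) (psi i)^* * A i j * psi j.

Definition lowner (I : finType) (A B : Op I) : Prop := psd (op_sub B A).

Definition pdensity (I : finType) (rho : Op I) : Prop := psd rho /\ op_trace rho <= 1.
Definition effect (I : finType) (M : Op I) : Prop := psd M /\ lowner M (@op_id I).

Definition so_linear (I : finType) (E : SuperOp I) : Prop :=
  forall (a : C) (x y : Op I),
    E (fun i j => a * x i j + y i j) = (fun i j => a * E x i j + E y i j).

(* E (x) id_A : tensoring with the identity on an ancilla with ONB A *)
Definition so_ext_anc (I A : finType) (E : SuperOp I) : SuperOp (prod I A) :=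
  fun rho x y => E (fun i j => rho (i, x.2) (j, y.2)) x.1 y.1.

Definition completely_positive (I : finType) (E : SuperOp I) : Prop :=
  forall (A : finType) (rho : Op (prod I A)), psd rho -> psd (@so_ext_anc I A E rho).

Definition trace_nonincreasing (I : finType) (E : SuperOp I) : Prop :=
  forall rho : Op I, psd rho -> op_trace (E rho) <= op_trace rho.

Definition trace_preserving (I : finType) (E : SuperOp I) : Prop :=
  forall rho : Op I, op_trace (E rho) = op_trace rho.

Definition so_sub (I : finType) (E F : SuperOp I) : SuperOp I :=
  fun rho i j => E rho i j - F rho i j.

Definition so_le (I : finType) (E F : SuperOp I) : Prop :=
  completely_positive (so_sub F E).

(* ---------- quantum variables (= nat), each a qubit ---------- *)
(* computational basis of H_S for a finite set of variables S *)
Definition bas (S : {fset nat}) := {ffun S -> bool}.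

Definition tot (S : {fset nat}) (b : bas S) : nat -> bool :=
  fun n => match insub n : option S with Some q => b q | None => false end.
Definition of_tot (S : {fset nat}) (f : nat -> bool) : bas S :=
  [ffun q : S => f (val q)].

Definition bres (X V : {fset nat}) (x : bas X) : bas V := of_tot V (tot x).
Definition bglue (X V : {fset nat}) (x : bas X) (v : bas V) : bas X :=
  of_tot X (fun n => if n \in V then tot v n else tot x n).

(* cylindric extension M (x) I of an operator on H_W to H_X *)
Definition op_ext (W X : {fset nat}) (M : Op (bas W)) : Op (bas X) :=
  fun x y => if [forall q : X, (val q \notin W) ==> (x q == y q)]
             then M (bres W x) (bres W y) else 0.

(* cylindric extension E (x) id of a super-operator on L(H_V) to L(H_X) *)
Definition so_ext (V X : {fset nat}) (E : SuperOp (bas V)) : SuperOp (bas X) :=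
  fun rho x y => E (fun v w => rho (bglue x v) (bglue y w)) (bres V x) (bres V y).

Definition DProg (V : {fset nat}) : set (SuperOp (bas V)) :=
  [set E | so_linear E /\ completely_positive E /\ trace_nonincreasing E].

Definition so_convex (I : finType) (S : set (SuperOp I)) : Prop :=
  forall E F, S E -> S F -> forall p : R, 0 <= p <= 1 ->
    S (fun rho i j => (p%:C)%C * E rho i j + ((1 - p)%:C)%C * F rho i j).

(* closedness (w.r.t. the unique finite-dimensional linear topology):
   limits of convergent sequences of elements of S stay in S *)
Definition so_closed (I : finType) (S : set (SuperOp I)) : Prop :=
  forall (u : nat -> SuperOp I) (L : SuperOp I),
    (forall n, S (u n)) ->
    (forall rho i j,
        (fun n => complex.Re (u n rho i j)) @ \oo --> complex.Re (L rho i j) /\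
        (fun n => complex.Im (u n rho i j)) @ \oo --> complex.Im (L rho i j)) ->
    S L.

Definition NProg (V : {fset nat}) (S : set (SuperOp (bas V))) : Prop :=
  S !=set0 /\ S `<=` @DProg V /\ so_convex S /\ so_closed S.

Definition apply_set (V X : {fset nat}) (S : set (SuperOp (bas V))) (rho : Op (bas X))
  : set (Op (bas X)) := [set @so_ext V X E rho | E in S].

Definition le_S (I : finType) (E F : set (SuperOp I)) : Prop :=
  forall F', F F' -> exists2 E', E E' & so_le E' F'.
Definition le_H (I : finType) (E F : set (SuperOp I)) : Prop :=
  forall E', E E' -> exists2 F', F F' & so_le E' F'.
Definition le_EM (I : finType) (E F : set (SuperOp I)) : Prop := le_H E F /\ le_S E F.

Definition upc (V : {fset nat}) (E : set (SuperOp (bas V))) : set (SuperOp (bas V)) :=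
  [set F | @DProg V F /\ exists2 E', E E' & so_le E' F].
Definition downc (V : {fset nat}) (E : set (SuperOp (bas V))) : set (SuperOp (bas V)) :=
  [set F | @DProg V F /\ exists2 E', E E' & so_le F E'].

Definition Exp_dem (W X : {fset nat}) (rho : Op (bas X)) (Theta : set (Op (bas W))) : R :=
  if asbool (Theta = set0) then complex.Re (op_trace rho)
  else inf [set complex.Re (op_trace (op_mul (@op_ext W X M) rho)) | M in Theta].

Definition models_tot (V W : {fset nat}) (E : set (SuperOp (bas V)))
  (Theta Psi : set (Op (bas W))) : Prop :=
  forall X : {fset nat}, fsubset (V `|` W)%fset X ->
  forall rho : Op (bas X), pdensity rho ->
    Exp_dem rho Theta <= inf [set Exp_dem sigma Psi | sigma in @apply_set V X E rho].

Definition models_par (V W : {fset nat}) (E : set (SuperOp (bas V)))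
  (Theta Psi : set (Op (bas W))) : Prop :=
  forall X : {fset nat}, fsubset (V `|` W)%fset X ->
  forall rho : Op (bas X), pdensity rho ->
    Exp_dem rho Theta <=
      inf [set Exp_dem sigma Psi + complex.Re (op_trace rho) - complex.Re (op_trace sigma)
          | sigma in @apply_set V X E rho].

Definition ref_T (V : {fset nat}) (E F : set (SuperOp (bas V))) : Prop :=
  forall (W : {fset nat}) (Theta Psi : set (Op (bas W))),
    Theta `<=` @effect (bas W) -> Psi `<=` @effect (bas W) ->
    models_tot E Theta Psi -> models_tot F Theta Psi.

Definition ref_P (V : {fset nat}) (E F : set (SuperOp (bas V))) : Prop :=
  forall (W : {fset nat}) (Theta Psi : set (Op (bas W))),
    Theta `<=` @effect (bas W) -> Psi `<=` @effect (bas W) ->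
    models_par E Theta Psi -> models_par F Theta Psi.

Definition equiv_T (V : {fset nat}) (E F : set (SuperOp (bas V))) : Prop :=
  ref_T E F /\ ref_T F E.
Definition equiv_P (V : {fset nat}) (E F : set (SuperOp (bas V))) : Prop :=
  ref_P E F /\ ref_P F E.

End QDefs.

(* Main.v *)
Require Import Defs.
From HB Require Import structures.
From mathcomp Require Import all_boot all_order all_algebra.
From mathcomp Require Import finmap complex.
From mathcomp Require Import boolp classical_sets reals topology normedtype sequences.
From mathcomp Require Import ring lra spectral.
Local Open Scope classical_set_scope.

(** Refinement follows from the order on super-operators because expectations of
    effects are monotone in the state. Conversely, suppose that [f] in [F] lies above
    no [e] in [E]. By Choi's theorem this says that the Choi matrix of [f] is not in
    (Choi matrices of [E]) + (positive cone). The first set is compact and convex, so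
    the sum is closed and a separating hyperplane exists; positivity on the cone makes
    it an effect [N]. Measuring [N] on the output of the maximally entangled state of
    [V] and a fresh copy of [V] separates [f] from [E], while the set [{e^*(N) | e in E}]
    of adjoint images is a precondition for [{N}] that [E] satisfies with equality.
    Partial correctness is the same argument for [1 - N]. For trace-preserving
    super-operators the order is equality, since a positive Choi matrix of trace
    zero vanishes. *)

Set Implicit Arguments.
Unset Strict Implicit.
Unset Printing Implicit Defensive.
Import Order.TTheory GRing.Theory Num.Theory.
Import numFieldNormedType.Exports.
Local Open Scope ring_scope.

(** * Closed convex sets in Euclidean space *)

Section Euclidean.
Variables (R : realType) (T : finType).
Implicit Types (x y z : T -> R) (S : set (T -> R)) (u : nat -> T -> R).

(** Closedness is sequential throughout, and no subsequence is ever extracted: points of least norm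
    in a nested family of bounded closed convex sets form a Cauchy sequence, which gives closedness
    of the sum with the cone. A least-norm point is also the normal of the hyperplane. Two features
    of satisfaction shape the rest. It quantifies over every system [X] containing [V] and [W],
    while a test is built on one [W]; the precondition must therefore be exact on all extensions,
    which follows because tracing out the variables outside [W] commutes with running the program.
    And the ancilla of the Choi construction must itself consist of quantum variables, so a disjoint
    copy of [V] has to be found. One effect suffices as postcondition because convexity merges the
    witnesses against the individual [e] into a single hyperplane, with a uniform gap. The demonic
    choice then sits in the precondition: an infimum over adjoint images is the infimum over the
    runs of [E]. *)

Definition dot x y : R := \sum_t x t * y t.

Definition vconvex S := forall x y, S x -> S y -> forall p : R, 0 <= p <= 1 ->
  S (fun t => p * x t + (1 - p) * y t).

Definition vcvg u x := forall t, u n t @[n --> \oo] --> x t.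

Definition vclosed S := forall u x, (forall n, S (u n)) -> vcvg u x -> S x.

Lemma dot_ge0 x : 0 <= dot x x.
Proof. by apply: sumr_ge0 => t _; rewrite -expr2 sqr_ge0. Qed.

Lemma dot_eq0 x : dot x x = 0 -> x = fun=> 0.
Proof.
move=> x0; apply/funext => t; apply/eqP; rewrite -sqrf_eq0 expr2.
by have /psumr_eq0P := x0; move=> -> // s _; rewrite -expr2 sqr_ge0.
Qed.

Lemma sqr_coord_le_dot x t : x t ^+ 2 <= dot x x.
Proof.
rewrite /dot (bigD1 t)//= -expr2 lerDl.
by apply: sumr_ge0 => s _; rewrite -expr2 sqr_ge0.
Qed.

Lemma dot_sqrD (a b : R) x y :
  dot (fun t => a * x t + b * y t) (fun t => a * x t + b * y t) =
  a ^+ 2 * dot x x + 2 * a * b * dot x y + b ^+ 2 * dot y y.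
Proof.
rewrite /dot !big_distrr/= -!big_split/=; apply: eq_bigr => t _; ring.
Qed.

Lemma dot_subr x y z : dot x (fun t => y t - z t) = dot x y - dot x z.
Proof. by rewrite /dot -sumrB; apply: eq_bigr => t _; rewrite mulrBr. Qed.

Lemma vcvg_dot u v x y : vcvg u x -> vcvg v y ->
  dot (u n) (v n) @[n --> \oo] --> dot x y.
Proof. by move=> ux vy; apply: cvg_big => [|t _]; [exact: add_continuous|exact: cvgM]. Qed.

Lemma vcvg_cauchy u (e : nat -> R) : e n @[n --> \oo] --> 0 ->
  (forall n m, (n <= m)%N ->
    dot (fun t => u m t - u n t) (fun t => u m t - u n t) <= e n) ->
  exists x, vcvg u x.
Proof.
move=> e0 ue.
have cu t : cvg (u n t @[n --> \oo]).
  apply/cauchy_cvgP/cauchy_ballP => eps eps0; near_simpl.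
  (* [e] bounds squared distances, and two late terms are compared through [u N]: hence the square
     and the half. *)
  have [N _ HN] : \forall n \near \oo, e n < (eps / 2) ^+ 2.
    by apply: (cvgr_lt 0) => //; rewrite exprn_gt0// divr_gt0.
  have H n : (N <= n)%N -> `|u n t - u N t| < eps / 2.
    move=> Nn; rewrite -(@ltr_pXn2r _ 2)// ?nnegrE ?normr_ge0// ?divr_ge0 ?ltW//.
    rewrite real_normK ?num_real//.
    apply: le_lt_trans (HN N _); last by rewrite /=.
    exact: le_trans (sqr_coord_le_dot (fun t => u n t - u N t) t) (ue _ _ Nn).
  exists ([set n | (N <= n)%N], [set n | (N <= n)%N]) => /=.
    by split; exists N.
  move=> [n m] [/= Nn Nm]; rewrite -ball_normE /=.
  have := H _ Nn; have := H _ Nm.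
  rewrite !ltr_norml => /andP[h1 h2] /andP[h3 h4].
  by apply/andP; split; lra.
exists (fun t => lim (u n t @[n --> \oo])) => t; exact: cu.
Unshelve. all: by end_near. Qed.

(** Projection of the origin onto [S]. A minimising sequence is Cauchy because midpoints stay in
    [S]; the inequality is the first-order condition at the minimum, since otherwise a small move
    towards [y] would shorten [x]. *)
Lemma min_norm S : S !=set0 -> vconvex S -> vclosed S ->
  exists2 x, S x & forall y, S y -> dot x x <= dot x y.
Proof.
move=> [s0 Ss0] Scvx Scl.
pose D := [set dot s s | s in S].
have Dlb : has_lbound D by exists 0 => _ [s _ <-]; exact: dot_ge0.
have Dinf : has_inf D by split => //; exists (dot s0 s0), s0.
have dle s : S s -> inf D <= dot s s by move=> Ss; apply: ge_inf => //; exists s.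
have /choice[u Hu] n : exists s, S s /\ dot s s < inf D + n.+1%:R^-1.
  have n0 : 0 < n.+1%:R^-1 :> R by rewrite invr_gt0.
  by have [_ [s Ss <-] ?] := inf_adherent n0 Dinf; exists s.
have e0 : (n.+1%:R^-1 : R) @[n --> \oo] --> 0 by exact: cvg_harmonic.
have [x ux] : exists x, vcvg u x.
  (* Parallelogram law: the squared distance is twice the sum of the two squared norms minus four
     times that of the midpoint, which is at least [inf D]. What remains is twice the sum of the two
     errors, and the error at [n] is the larger one. *)
  apply: (@vcvg_cauchy u (fun n => 4 * n.+1%:R^-1)).
    by rewrite -[X in _ --> X](mulr0 4); apply: cvgM => //; exact: cvg_cst.
  move=> n m nm; have [Sn un] := Hu n; have [Sm um] := Hu m.
  have half : 0 <= (1 / 2 : R) <= 1 by lra.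
  have := dle _ (Scvx _ _ Sn Sm _ half).
  have mn : m.+1%:R^-1 <= n.+1%:R^-1 :> R by rewrite lef_pV2 ?posrE// ler_nat.
  rewrite dot_sqrD => h.
  have -> : (fun t => u m t - u n t) = (fun t => (-1) * u n t + 1 * u m t).
    by apply/funext => t; ring.
  rewrite dot_sqrD; move: un um mn h; set a := _^-1; set b := _^-1.
  set i := inf _; set d1 := dot _ _; set d2 := dot _ _; set d3 := dot _ _.
  by move=> *; lra.
exists x; first by apply: Scl ux => n; have [] := Hu n.
move=> y Sy.
have xD : dot x x <= inf D.
  have h := vcvg_dot ux ux.
  have h2 : (inf D + n.+1%:R^-1) @[n --> \oo] --> inf D.
    rewrite -[X in _ --> X](addr0 (inf D)); apply: cvgD => //; exact: cvg_cst.
  apply: (ler_cvg_to h h2); near=> n; have [_ /ltW//] := Hu n.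
have Sx : S x by apply: Scl ux => n; have [] := Hu n.
rewrite leNgt; apply/negP => lt.
set a := dot x x in lt xD *; set b := dot x y in lt *; set c := dot y y.
have ab : 0 < a - b by lra.
have q0 : 0 <= a - 2 * b + c.
  have -> : a - 2 * b + c =
      dot (fun t => 1 * x t + (-1) * y t) (fun t => 1 * x t + (-1) * y t).
    by rewrite dot_sqrD /a /b /c; ring.
  exact: dot_ge0.
(* Along the segment the squared norm is [a - p * (2 * (a - b) - p * q)] with [q] the squared
   distance of [x] and [y]. The minimiser [(a - b) / q] may exceed 1; adding [a - b] to the
   denominator keeps [p] in the unit interval and the decrease strict. *)
pose p := (a - b) / (a - b + (a - 2 * b + c)).
have den : 0 < a - b + (a - 2 * b + c) by lra.
have p0 : 0 < p by rewrite divr_gt0.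
have p1 : p <= 1 by rewrite ler_pdivrMr// mul1r; lra.
have pe : p * (a - b + (a - 2 * b + c)) = a - b by rewrite divfK// gt_eqF.
have p01 : 0 <= p <= 1 by rewrite ltW.
have := dle _ (Scvx _ _ Sy Sx _ p01).
rewrite dot_sqrD -/a -/c.
have -> : dot y x = b by apply: eq_bigr => t _; rewrite mulrC.
move=> h.
have h3 : p ^+ 2 * c + 2 * p * (1 - p) * b + (1 - p) ^+ 2 * a =
   a - p * (2 * (a - b) - p * (a - 2 * b + c)) by ring.
rewrite h3 in h.
have : 0 < p * (2 * (a - b) - p * (a - 2 * b + c)).
  apply: mulr_gt0 => //.
  have : 0 < p * (a - b) by apply: mulr_gt0.
  by move: pe; rewrite mulrDr; lra.
lra.
Unshelve. all: by end_near. Qed.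

(** Replaces compactness. The squared norms [q n] of the least-norm points increase and are bounded
    by [B], and the first-order condition at [u n] bounds the squared distance to [u m] by
    [q m - q n]. *)
Lemma nested_convex (K : nat -> set (T -> R)) (B : R) :
  (forall n, K n !=set0) -> (forall n, vconvex (K n)) ->
  (forall n, vclosed (K n)) -> (forall n m, (n <= m)%N -> K m `<=` K n) ->
  (forall x, K 0%N x -> dot x x <= B) -> exists x, forall n, K n x.
Proof.
move=> Kn0 Kcvx Kcl Kdec KB.
have /choice[u Hu] n : exists x, K n x /\ forall y, K n y -> dot x x <= dot x y.
  by have [x] := min_norm (Kn0 n) (@Kcvx n) (@Kcl n); exists x.
pose q n := dot (u n) (u n).
have um n m : (n <= m)%N ->
    dot (fun t => u m t - u n t) (fun t => u m t - u n t) <= q m - q n.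
  move=> nm; have [_ /(_ (u m))] := Hu n.
  move=> /(_ (Kdec _ _ nm _ (proj1 (Hu m)))) h.
  have -> : (fun t => u m t - u n t) = (fun t => (-1) * u n t + 1 * u m t).
    by apply/funext => t; ring.
  by rewrite dot_sqrD /q; lra.
have qnd : nondecreasing_seq q.
  move=> n m nm; rewrite -subr_ge0; apply: le_trans (um _ _ nm); exact: dot_ge0.
have qc : cvg (q n @[n --> \oo]).
  apply: nondecreasing_is_cvgn => //; exists B => _ [n _ <-]; apply: KB.
  by apply: (Kdec 0%N n) => //; have [] := Hu n.
have [x ux] : exists x, vcvg u x.
  apply: (@vcvg_cauchy u (fun n => lim (q n @[n --> \oo]) - q n)).
    rewrite -[X in _ --> X](subrr (lim (q n @[n --> \oo]))).
    apply: cvgB => //; exact: cvg_cst.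
  move=> n m nm; apply: le_trans (um _ _ nm) _; rewrite lerD2r.
  exact: nondecreasing_cvgn_le.
(* Only the terms from index [n] on are known to lie in [K n]. *)
exists x => n; apply: (Kcl n (fun k => u (k + n)%N)).
  by move=> k; apply: (Kdec n (k + n)%N); [exact: leq_addl | have [] := Hu (k + n)%N].
move=> t; have := ux t.
by rewrite -(cvg_shiftn n (fun k => u k t)).
Qed.

End Euclidean.

(** * Closed sums of convex sets and the separating hyperplane *)

Section Separation.
Variables (R : realType) (T : finType).
Implicit Types (p : T -> R) (u : nat -> T -> R).

(* The pairs [(a, b)] in [A * B] with [a + b] close to the limit form a nested family. *)
Lemma closed_sum (A B : set (T -> R)) (M : R) :
  vconvex A -> vconvex B -> vclosed A -> vclosed B ->
  (forall x t, A x -> `|x t| <= M) ->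
  vclosed [set s | exists a b, [/\ A a, B b & s = fun t => a t + b t]].
Proof.
move=> Acvx Bcvx Acl Bcl AM u l uS ul.
pose K (n : nat) : set (T + T -> R) := [set z : T + T -> R | [/\ A (z \o inl), B (z \o inr) &
  forall t, `|z (inl t) + z (inr t) - l t| <= n.+1%:R^-1]].
have [z Kz] : exists z, forall n, K n z.
  (* Coordinates of [a] are bounded by [M]. Those of [b] are bounded too, since
     [b = (a + b - l) + l - a] and the tolerance at index 0 is 1. *)
  apply: (@nested_convex R (T + T)%type K
    (\sum_(s : T + T) match s with inl t => M ^+ 2 | inr t => (`|l t| + 1 + M) ^+ 2 end)).
  - move=> n.
    have [m um] : exists m, forall t, `|u m t - l t| <= n.+1%:R^-1.
      have n0 : 0 < n.+1%:R^-1 :> R by rewrite invr_gt0.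
      have : \forall m \near \oo, forall t, `|u m t - l t| <= n.+1%:R^-1.
        apply: filter_forall => t.
        have /cvgrPdist_le /(_ _ n0) := ul t.
        by apply: filterS => m; rewrite distrC.
      by move=> [m _ Hm]; exists m; apply: Hm => /=.
    have [a [b [Aa Bb uab]]] := uS m.
    exists (fun s => match s with inl t => a t | inr t => b t end); split => //= t.
    by have := um t; rewrite uab.
  - move=> n x y [Ax Bx xl] [Ay By yl] p p01; split.
    + exact: (Acvx _ _ Ax Ay _ p01).
    + exact: (Bcvx _ _ Bx By _ p01).
    move=> t /=; have := xl t; have := yl t; move: (n.+1%:R^-1) => e.
    rewrite !ler_norml => /andP[y1 y2] /andP[x1 x2].
    have /andP[p0 p1] := p01; have q0 : 0 <= 1 - p by lra.
    have {}x1 := ler_wpM2l p0 x1; have {}x2 := ler_wpM2l p0 x2.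
    have {}y1 := ler_wpM2l q0 y1; have {}y2 := ler_wpM2l q0 y2.
    apply/andP; split; lra.
  - move=> n v x vK vx; split.
    + by apply: (Acl (fun k => v k \o inl)) => [k|t]; [have [] := vK k | exact: vx].
    + by apply: (Bcl (fun k => v k \o inr)) => [k|t]; [have [] := vK k | exact: vx].
    move=> t.
    have h : `|v k (inl t) + v k (inr t) - l t| @[k --> \oo] -->
        `|x (inl t) + x (inr t) - l t|.
      apply: cvg_norm; apply: cvgB; last exact: cvg_cst.
      by apply: cvgD; apply: vx.
    apply: (cvgr_to_le h); near=> k.
    by have [_ _] := vK k.
  - move=> n m nm z [Az Bz zl]; split => // t; apply: le_trans (zl t) _.
    by rewrite lef_pV2 ?posrE// ler_nat.
  - move=> z [Az Bz zl]; apply: ler_sum => -[t|t] _; rewrite -expr2.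
      rewrite -real_normK ?num_real// lerXn2r ?nnegrE//.
        by apply: le_trans (AM _ t Az).
      exact: (AM _ t Az).
    have hA := AM _ t Az; have := zl t; rewrite invr1 => hz.
    rewrite -real_normK ?num_real// lerXn2r ?nnegrE//.
      by rewrite !addr_ge0// (le_trans _ hA).
    have -> : z (inr t) = (z (inl t) + z (inr t) - l t) + l t - z (inl t) by ring.
    apply: le_trans (ler_normB _ _) _; apply: lerD => //.
    apply: le_trans (ler_normD _ _) _; rewrite addrC; exact: lerD.
exists (z \o inl), (z \o inr); split; [by have [] := Kz 0%N | by have [] := Kz 0%N |].
apply/funext => t /=.
have : `|z (inl t) + z (inr t) - l t| <= 0.
  have h : (n.+1%:R^-1 : R) @[n --> \oo] --> 0 by exact: cvg_harmonic.
  apply: (cvgr_to_ge h); near=> n; by have [_ _] := Kz n.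
by rewrite normr_le0 subr_eq0 => /eqP ->.
Unshelve. all: by end_near. Qed.

(** The normal [N] is the least-norm point of [A + B - p]. It is nonzero because [p] is not in
    [A + B], and its squared norm is the gap [d]. *)
Lemma separation (A B : set (T -> R)) (M : R) p :
  A !=set0 -> B !=set0 ->
  vconvex A -> vconvex B -> vclosed A -> vclosed B ->
  (forall x t, A x -> `|x t| <= M) ->
  (forall a b, A a -> B b -> p <> (fun t => a t + b t)) ->
  exists N (d : R), 0 < d /\
    forall a b, A a -> B b -> dot N p + d <= dot N a + dot N b.
Proof.
move=> [a0 Aa0] [b0 Bb0] Acvx Bcvx Acl Bcl AM nAB.
pose S : set (T -> R) :=
  [set s | exists a b, [/\ A a, B b & s = fun t => a t + b t - p t]].
have [|||N SN HN] := @min_norm R T S.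
- by exists (fun t => a0 t + b0 t - p t), a0, b0.
- move=> _ _ [a [b [Aa Bb ->]]] [a' [b' [Aa' Bb' ->]]] q q01.
  exists (fun t => q * a t + (1 - q) * a' t), (fun t => q * b t + (1 - q) * b' t).
  by split; [exact: Acvx | exact: Bcvx | apply/funext => t; ring].
- move=> u x uS ux.
  have [||a [b [Aa Bb E]]] := closed_sum Acvx Bcvx Acl Bcl AM
      (u := fun n t => u n t + p t) (x := fun t => x t + p t).
  + move=> n; have [a [b [Aa Bb E]]] := uS n; exists a, b; split => //.
    by rewrite E; apply/funext => t; ring.
  + by move=> t; apply: cvgD; [exact: ux | exact: cvg_cst].
  exists a, b; split => //; apply/funext => t.
  by have := congr1 (@^~ t) E => /= <-; ring.
- exists N, (dot N N); split.
    rewrite lt0r dot_ge0 andbT; apply/eqP => /dot_eq0 N0.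
    have [a [b [Aa Bb E]]] := SN; apply: (nAB a b Aa Bb).
    apply/funext => t; have := congr1 (@^~ t) E; rewrite N0 /= => /esym/eqP.
    by rewrite subr_eq0 => /eqP ->.
  move=> a b Aa Bb.
  have := HN (fun t => a t + b t - p t); rewrite dot_subr.
  have -> : dot N (fun t => a t + b t) = dot N a + dot N b.
    by rewrite /dot -big_split/=; apply: eq_bigr => t _; rewrite mulrDr.
  by move=> /(_ _)/wrap[|h]; [exists a, b | lra].
Qed.

End Separation.

(** * Positive operators *)

Section ComplexFacts.
Variable R : realType.
Local Notation C := R[i].
Implicit Types (z w : C) (u : nat -> C).

Lemma cReD z w : complex.Re (z + w) = complex.Re z + complex.Re w.
Proof. by case: z; case: w. Qed.

Lemma cImD z w : complex.Im (z + w) = complex.Im z + complex.Im w.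
Proof. by case: z; case: w. Qed.

Lemma cReN z : complex.Re (- z) = - complex.Re z.
Proof. by case: z. Qed.

Lemma cReB z w : complex.Re (z - w) = complex.Re z - complex.Re w.
Proof. by rewrite cReD cReN. Qed.

Lemma cReM z w :
  complex.Re (z * w) = complex.Re z * complex.Re w - complex.Im z * complex.Im w.
Proof. by case: z; case: w. Qed.

Lemma cImM z w :
  complex.Im (z * w) = complex.Re z * complex.Im w + complex.Im z * complex.Re w.
Proof. by case: z; case: w. Qed.

Lemma eq_Re_Im z w :
  complex.Re z = complex.Re w -> complex.Im z = complex.Im w -> z = w.
Proof. by case: z => a b; case: w => c d /= -> ->. Qed.

Lemma Re_sum (I : finType) (f : I -> C) :
  complex.Re (\sum_i f i) = \sum_i complex.Re (f i).
Proof. by elim/big_ind2: _ => // ? ? ? ? <- <-; rewrite cReD. Qed.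

Lemma Im_sum (I : finType) (f : I -> C) :
  complex.Im (\sum_i f i) = \sum_i complex.Im (f i).
Proof. by elim/big_ind2: _ => // ? ? ? ? <- <-; rewrite cImD. Qed.

Lemma conj_sum (I : finType) (f : I -> C) : (\sum_i f i)^* = \sum_i (f i)^*.
Proof. exact: rmorph_sum. Qed.

Lemma ge0_conj z : 0 <= z -> z^* = z.
Proof. by move=> /geC0_conj. Qed.

Lemma ge0_Re z : 0 <= z -> 0 <= complex.Re z.
Proof. by rewrite lecE => /andP[]. Qed.

Lemma le_Re z w : z <= w -> complex.Re z <= complex.Re w.
Proof. by rewrite lecE => /andP[]. Qed.

Lemma Re_real_mul (a : R) z : complex.Re (a%:C%C * z) = a * complex.Re z.
Proof. by rewrite cReM /= mul0r subr0. Qed.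

Lemma Re_le_norm z : `|complex.Re z|%:C%C <= `|z|.
Proof.
case: z => a b /=.
rewrite -[Num.norm (a +i* b)%C]/(Num.sqrt (a ^+ 2 + b ^+ 2))%:C%C lecR.
by rewrite -sqrtr_sqr ler_sqrt ?addr_ge0 ?sqr_ge0// lerDl sqr_ge0.
Qed.

Lemma Im_le_norm z : `|complex.Im z|%:C%C <= `|z|.
Proof.
case: z => a b /=.
rewrite -[Num.norm (a +i* b)%C]/(Num.sqrt (a ^+ 2 + b ^+ 2))%:C%C lecR.
by rewrite -sqrtr_sqr ler_sqrt ?addr_ge0 ?sqr_ge0// lerDr sqr_ge0.
Qed.

(** The same form as in [so_closed], so that closedness hypotheses apply directly and no topology on
    [C] is involved. *)
Definition ccvg u z :=
  complex.Re (u n) @[n --> \oo] --> complex.Re z /\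
  complex.Im (u n) @[n --> \oo] --> complex.Im z.

Lemma ccvg_mull w u z : ccvg u z -> ccvg (fun n => w * u n) (w * z).
Proof.
move=> [uR uI]; split.
  under eq_fun do rewrite cReM.
  by rewrite cReM; apply: cvgB; apply: cvgM => //; exact: cvg_cst.
under eq_fun do rewrite cImM.
by rewrite cImM; apply: cvgD; apply: cvgM => //; exact: cvg_cst.
Qed.

Lemma ccvg_sum (I : finType) (u : I -> nat -> C) (z : I -> C) :
  (forall i, ccvg (u i) (z i)) -> ccvg (fun n => \sum_i u i n) (\sum_i z i).
Proof.
move=> uz; split.
  under eq_fun do rewrite Re_sum.
  by rewrite Re_sum; apply: cvg_big => [|i _]; [exact: add_continuous | case: (uz i)].
under eq_fun do rewrite Im_sum.
by rewrite Im_sum; apply: cvg_big => [|i _]; [exact: add_continuous | case: (uz i)].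
Qed.

Lemma ccvg_ge0 u z : ccvg u z -> (forall n, 0 <= u n) -> 0 <= z.
Proof.
move=> [uR uI] u0; rewrite lecE; apply/andP; split.
  have u00 : (fun n => complex.Im (u n)) = fun=> 0.
    by apply/funext => n; have := u0 n; rewrite lecE => /andP[/eqP].
  rewrite u00 in uI; apply/eqP/(cvg_unique _ uI) => //; exact: cvg_cst.
apply: (cvgr_to_ge uR); near=> n; exact: ge0_Re.
Unshelve. all: by end_near. Qed.

End ComplexFacts.

Section Operators.
Variable R : realType.
Local Notation C := R[i].

Lemma sum_delta (I : finType) (i : I) (f : I -> C) :
  \sum_k f k * (if k == i then 1 else 0) = f i.
Proof.
rewrite (bigD1 i)//= eqxx mulr1 big1 ?addr0// => k /negbTE ->.
by rewrite mulr0.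
Qed.

Section Positive.
Variable I : finType.
Implicit Types (A B M : Op R I) (psi phi : I -> C).

Definition op_hermitian A := forall i j, A j i = (A i j)^*.

Definition qform A psi phi : C := \sum_i \sum_j (psi i)^* * A i j * phi j.

(** The rank-one operator |psi><psi|, not normalised. Trace identities against it are values of
    quadratic forms. *)
Definition ket psi : Op R I := fun i j => psi i * (psi j)^*.

Lemma op_trace_mul A B : op_trace (op_mul A B) = \sum_i \sum_j A i j * B j i.
Proof. by []. Qed.

Lemma op_trace_mulC A B : op_trace (op_mul A B) = op_trace (op_mul B A).
Proof.
rewrite !op_trace_mul exchange_big/=; apply: eq_bigr => i _.
by apply: eq_bigr => j _; rewrite mulrC.
Qed.

Lemma op_trace_id A : op_trace (op_mul (@op_id R I) A) = op_trace A.
Proof.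
apply: eq_bigr => i _; rewrite /op_mul /op_id -[RHS](sum_delta i (fun k => A k i)).
by apply: eq_bigr => k _; rewrite eq_sym mulrC.
Qed.

Lemma op_trace_subl A B M :
  op_trace (op_mul (op_sub A B) M) = op_trace (op_mul A M) - op_trace (op_mul B M).
Proof.
rewrite !op_trace_mul -sumrB; apply: eq_bigr => i _.
by rewrite -sumrB; apply: eq_bigr => j _; rewrite mulrBl.
Qed.

Lemma op_trace_subr A B M :
  op_trace (op_mul M (op_sub A B)) = op_trace (op_mul M A) - op_trace (op_mul M B).
Proof. by rewrite op_trace_mulC op_trace_subl !(op_trace_mulC M). Qed.

Lemma op_trace_scalel (c : C) A B :
  op_trace (op_mul (fun i j => c * A i j) B) = c * op_trace (op_mul A B).
Proof.
rewrite !op_trace_mul mulr_sumr; apply: eq_bigr => i _.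
by rewrite mulr_sumr; apply: eq_bigr => j _; rewrite mulrA.
Qed.

Lemma op_trace_sub A B : op_trace (op_sub A B) = op_trace A - op_trace B.
Proof. by rewrite /op_trace -sumrB. Qed.

Lemma op_trace_mul_ket A psi : op_trace (op_mul A (ket psi)) = qform A psi psi.
Proof.
apply: eq_bigr => i _; apply: eq_bigr => j _; rewrite /ket; ring.
Qed.

Lemma psd_ket psi : psd (ket psi).
Proof.
move=> phi; rewrite /ket.
have -> : \sum_i \sum_j (phi i)^* * (psi i * (psi j)^*) * phi j =
    (\sum_i (phi i)^* * psi i) * (\sum_i (phi i)^* * psi i)^*.
  rewrite conj_sum big_distrl/=; apply: eq_bigr => i _.
  rewrite big_distrr/=; apply: eq_bigr => j _; rewrite rmorphM/= conjCK; ring.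
exact: mul_conjC_ge0.
Qed.

Lemma qform_delta A i j (c : C) :
  let psi k := (if k == i then 1 else 0) + c * (if k == j then 1 else 0) in
  qform A psi psi = A i i + c * A i j + c^* * A j i + c^* * c * A j j.
Proof.
move=> psi; rewrite /qform.
have inner k : \sum_l (psi k)^* * A k l * psi l =
    (A k i + c * A k j) * (psi k)^*.
  transitivity (\sum_l (((psi k)^* * A k l) * (if l == i then 1 else 0) +
      (c * (psi k)^* * A k l) * (if l == j then 1 else 0))).
    apply: eq_bigr => l _; move: (psi k)^* => w; rewrite /psi.
    by rewrite mulrDr; congr (_ + _); rewrite !mulrA; congr (_ * _); ring.
  by rewrite big_split/= !sum_delta; move: (psi k)^* => w; ring.
under eq_bigr do rewrite inner.
have conjif (b : bool) : (if b then 1 else 0 : C)^* = if b then 1 else 0.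
  by case: b; rewrite ?conjC1 ?conjC0.
transitivity (\sum_k ((A k i + c * A k j) * (if k == i then 1 else 0) +
    (c^* * (A k i + c * A k j)) * (if k == j then 1 else 0))).
  apply: eq_bigr => k _; rewrite /psi rmorphD rmorphM/= !conjif mulrDr.
  by congr (_ + _); rewrite mulrCA mulrA.
by rewrite big_split/= !sum_delta; move: (c^*) => w; ring.
Qed.

Lemma psd_diag_ge0 A i : psd A -> 0 <= A i i.
Proof.
move=> pA; have /= := pA (fun k => (if k == i then 1 else 0) + 0 * (if k == i then 1 else 0)).
by have /= := qform_delta A i i 0; rewrite /qform => ->; rewrite conjC0 !mul0r !addr0.
Qed.

(** Being nonnegative in [C] includes being real. Applied to the vectors e_i + c e_j, this makes the
    off-diagonal contribution real; [c = 1] and [c = 'i] together determine the entry. *)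
Lemma psd_hermitian A : psd A -> op_hermitian A.
Proof.
move=> pA i j.
have h c : (c * A i j + c^* * A j i)^* = c * A i j + c^* * A j i.
  have /= := pA (fun k => (if k == i then 1 else 0) + c * (if k == j then 1 else 0)).
  have /= := qform_delta A i j c; rewrite /qform => -> /ge0_conj.
  rewrite !rmorphD/= !rmorphM/= conjCK (ge0_conj (psd_diag_ge0 i pA)).
  rewrite (ge0_conj (psd_diag_ge0 j pA)) [c * c^*]mulrC -!addrA => /addrI.
  by rewrite !addrA => /addIr.
have := h 1; have := h 'i; rewrite !rmorphD/= !rmorphM/= conjCK conjCi rmorph1.
set a := A i j; set b := A j i => h2 h1.
have nz : ('i : C) != 0 by exact: neq0Ci.
have h3 : - a^* + b^* = a - b.
  by apply: (mulfI nz); rewrite -[RHS]/('i * (a - b)) !mulrDr; move: h2; rewrite !mulNr !mulrN.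
rewrite !mul1r in h1.
have e : 2 * b = 2 * a^*.
  have -> : 2 * b = (a + b) - (a - b) by ring.
  by rewrite -h1 -h3; ring.
by apply: mulfI e; rewrite pnatr_eq0.
Qed.

(** Spectral theorem: the eigenvalues are values of the form at eigenvectors, hence nonnegative, and
    their square roots are absorbed into the eigenvectors. The detour through ordinals is needed to
    speak of matrices. *)
Lemma psd_decomp A : psd A ->
  exists v : 'I_#|I| -> I -> C, forall i j, A i j = \sum_k v k i * (v k j)^*.
Proof.
move=> pA; have hA := psd_hermitian pA.
pose m : 'M[C]_#|I| := \matrix_(a, b) A (enum_val a) (enum_val b).
have mt : (m ^t*)%sesqui = m by apply/matrixP => a b; rewrite !mxE -hA.
have mn : m \is normalmx by apply/normalmxP; rewrite mt.
have := orthomx_spectralP mn; set P := spectralmx m; set D := spectral_diag m.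
have Pu : P \is unitarymx by exact: spectral_unitarymx.
rewrite /= (invmx_unitary Pu) => mE.
have PP := unitarymxP Pu.
have DE : diag_mx D = P *m m *m (P ^t*)%sesqui.
  by rewrite mE !mulmxA PP mul1mx -mulmxA PP mulmx1.
have D0 k : 0 <= D 0 k.
  have -> : D 0 k = (diag_mx D) k k by rewrite !mxE eqxx mulr1n.
  have := pA (fun i => (P k (enum_rank i))^*); congr (0 <= _).
  rewrite DE mxE [RHS](reindex_onto enum_rank enum_val) /=; last by move=> a _; exact: enum_valK.
  rewrite exchange_big/= [RHS](eq_bigl predT); last by move=> i; rewrite enum_rankK eqxx.
  apply: eq_bigr => j _; rewrite !mxE big_distrl/=.
  rewrite [RHS](reindex_onto enum_rank enum_val) /=; last by move=> a _; exact: enum_valK.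
  rewrite [RHS](eq_bigl predT); last by move=> i; rewrite enum_rankK eqxx.
  by apply: eq_bigr => i _; rewrite !mxE !enum_rankK conjCK.
exists (fun k i => sqrtC (D 0 k) * (P k (enum_rank i))^*) => i j.
have -> : A i j = m (enum_rank i) (enum_rank j) by rewrite mxE !enum_rankK.
rewrite {1}mE mxE; apply: eq_bigr => k _.
rewrite mul_mx_diag !mxE rmorphM/= conjCK (ge0_conj (_ : 0 <= sqrtC _)) ?sqrtC_ge0//.
by rewrite -{1}[D 0 k]sqrtCK; ring.
Qed.

Lemma op_trace_mul_ge0 A B : psd A -> psd B -> 0 <= op_trace (op_mul A B).
Proof.
move=> pA /psd_decomp[v vE].
have -> : op_trace (op_mul A B) = \sum_k qform A (v k) (v k).
  under [RHS]eq_bigr do rewrite -op_trace_mul_ket.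
  rewrite /op_trace [RHS]exchange_big/=; apply: eq_bigr => i _.
  rewrite /op_mul [RHS]exchange_big/=; apply: eq_bigr => j _.
  by rewrite vE big_distrr.
by apply: sumr_ge0 => k _; exact: pA.
Qed.

Lemma psd_trace_ge0 A : psd A -> 0 <= op_trace A.
Proof. by move=> pA; apply: sumr_ge0 => i _; exact: psd_diag_ge0. Qed.

Lemma psd_diag_le_trace A i : psd A -> A i i <= op_trace A.
Proof.
move=> pA; rewrite /op_trace (bigD1 i)//= lerDl.
by apply: sumr_ge0 => j _; exact: psd_diag_ge0.
Qed.

Lemma norm_mul_le_half (a b : C) : `|a * b| <= (`|a| ^+ 2 + `|b| ^+ 2) / 2.
Proof.
rewrite normrM ler_pdivlMr ?ltr0n// -subr_ge0.
have -> : `|a| ^+ 2 + `|b| ^+ 2 - `|a| * `|b| * 2 = (`|a| - `|b|) ^+ 2 by ring.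
by apply: real_exprn_even_ge0 => //; rewrite realB ?normr_real.
Qed.

(** From the Gram form of [psd_decomp] and the arithmetic-geometric mean, an entry is at most the
    mean of the two diagonal entries. *)
Lemma psd_norm_le_trace A i j : psd A -> `|A i j| <= op_trace A.
Proof.
move=> pA; have [v vE] := psd_decomp pA.
have d k : A k k = \sum_l `|v l k| ^+ 2.
  by rewrite vE; apply: eq_bigr => l _; rewrite normCK.
apply: (@le_trans _ _ ((A i i + A j j) / 2)).
  rewrite !d -big_split/= big_distrl/= vE; apply: le_trans (ler_norm_sum _ _ _) _.
  apply: ler_sum => l _; apply: le_trans (norm_mul_le_half _ _) _.
  by rewrite norm_conjC.
rewrite ler_pdivrMr ?ltr0n// mulr_natr mulr2n.
by apply: lerD; exact: psd_diag_le_trace.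
Qed.

Lemma psd_trace_eq0 A : psd A -> op_trace A = 0 -> forall i j, A i j = 0.
Proof.
move=> pA t0 i j; apply/eqP; rewrite -normr_le0 -t0; exact: psd_norm_le_trace.
Qed.

(** Crude: every entry is bounded by the trace, and summing |psi_i| |psi_j| over all pairs costs the
    factor [#|I|]. Some scalar bound is all that is required to rescale a positive operator to an
    effect. *)
Lemma psd_le_scalar A : psd A ->
  psd (op_sub (fun i j => (#|I|%:R * op_trace A) * @op_id R I i j) A).
Proof.
move=> pA psi; rewrite -/(qform _ psi psi) -op_trace_mul_ket op_trace_subl.
rewrite op_trace_scalel op_trace_id op_trace_mul_ket subr_ge0.
rewrite -[qform _ _ _]ger0_norm; last exact: pA.
apply: le_trans (ler_norm_sum _ _ _) _.
have -> : #|I|%:R * op_trace A * op_trace (ket psi) =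
    \sum_i \sum_j op_trace A * ((`|psi i| ^+ 2 + `|psi j| ^+ 2) / 2).
  have -> : op_trace (ket psi) = \sum_i `|psi i| ^+ 2.
    by apply: eq_bigr => i _; rewrite normCK.
  set S := \sum_i (`|psi i| ^+ 2); set t := op_trace A.
  have inner i : \sum_j t * ((`|psi i| ^+ 2 + `|psi j| ^+ 2) / 2) =
      t / 2 * (#|I|%:R * `|psi i| ^+ 2 + S).
    rewrite -mulr_sumr -mulr_suml big_split/= sumr_const -[(`|psi i| ^+ 2) *+ _]mulr_natl -/S.
    by rewrite mulrA mulrAC.
  under eq_bigr do rewrite inner.
  rewrite -mulr_sumr big_split/= -mulr_sumr sumr_const -[S *+ _]mulr_natl -/S.
  by field.
apply: ler_sum => i _; apply: le_trans (ler_norm_sum _ _ _) _.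
apply: ler_sum => j _; rewrite mulrAC normrM mulrC; apply: ler_pM => //.
  exact: psd_norm_le_trace.
by apply: le_trans (norm_mul_le_half _ _) _; rewrite norm_conjC.
Qed.

Lemma psdD A B : psd A -> psd B -> psd (fun i j => A i j + B i j).
Proof.
move=> pA pB psi.
have -> : \sum_i \sum_j (psi i)^* * (A i j + B i j) * psi j = qform A psi psi + qform B psi psi.
  rewrite -big_split/=; apply: eq_bigr => i _; rewrite -big_split/=.
  by apply: eq_bigr => j _; ring.
by apply: addr_ge0; [exact: pA | exact: pB].
Qed.

Lemma psdZ (c : C) A : 0 <= c -> psd A -> psd (fun i j => c * A i j).
Proof.
move=> c0 pA psi.
have -> : \sum_i \sum_j (psi i)^* * (c * A i j) * psi j = c * qform A psi psi.
  rewrite big_distrr/=; apply: eq_bigr => i _; rewrite big_distrr/=.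
  by apply: eq_bigr => j _; ring.
by apply: mulr_ge0 => //; exact: pA.
Qed.

End Positive.
End Operators.

(** * Separation from the positive cone *)

Section OperatorSeparation.
Variables (R : realType) (K : finType).
Local Notation C := R[i].
Implicit Types (A p : Op R K) (x N : K * K * bool -> R) (S : set (Op R K)).

Definition emb A : K * K * bool -> R := fun t =>
  if t.2 then complex.Re (A t.1.1 t.1.2) else complex.Im (A t.1.1 t.1.2).

Definition unemb x : Op R K := fun i j => (x (i, j, true) +i* x (i, j, false))%C.

Lemma embK A : unemb (emb A) = A.
Proof. by apply/funext => i; apply/funext => j; rewrite /unemb /emb /=; case: (A i j). Qed.

Definition hermitian_part A : Op R K := fun i j => ((A j i)^* + A i j) / 2.

Lemma dot_unemb N x :
  dot N x = complex.Re (\sum_i \sum_j (unemb N i j)^* * unemb x i j).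
Proof.
rewrite Re_sum; under [RHS]eq_bigr do rewrite Re_sum.
rewrite pair_bigA/= /dot.
transitivity (\sum_(q : K * K) \sum_(b : bool) N (q, b) * x (q, b)).
  by rewrite pair_bigA; apply: eq_bigr => -[q b] _.
apply: eq_bigr => -[i j] _ /=; rewrite big_bool/=; ring.
Qed.

(* Pairing with [N] sees only the Hermitian part of the matrix encoded by [N]. *)
Lemma trace_hermitian_part N A : op_hermitian A ->
  op_trace (op_mul (hermitian_part (unemb N)) A) = (dot N (emb A))%:C%C.
Proof.
move=> hA; rewrite dot_unemb embK; set z := \sum_i _.
have -> : (complex.Re z)%:C%C = (z + z^*) / 2.
  apply: (mulIf (_ : (2 : C) != 0)); first by rewrite pnatr_eq0.
  rewrite divfK ?pnatr_eq0// mulr_natr mulr2n.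
  case: (z) => a b; apply: eq_Re_Im; first by [].
  by rewrite [LHS]addr0 [RHS]subrr.
rewrite op_trace_mul {2}/z conj_sum mulrDl.
have -> : z / 2 = \sum_i \sum_j (unemb N j i)^* * A j i / 2.
  rewrite /z exchange_big/= mulr_suml; apply: eq_bigr => i _.
  by rewrite mulr_suml.
rewrite mulr_suml -big_split/=; apply: eq_bigr => i _.
rewrite conj_sum mulr_suml -big_split/=; apply: eq_bigr => j _.
rewrite rmorphM/= conjCK -hA /hermitian_part; ring.
Qed.

(** Separation of [p] from [S] plus the positive cone, in real coordinates. The Hermitian hypotheses
    let the normal be replaced by its Hermitian part, which is positive and can be scaled down to an
    effect. *)
Lemma psd_separation S p (B : R) :
  S !=set0 ->
  (forall a b, S a -> S b -> forall q : R, 0 <= q <= 1 ->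
    S (fun i j => q%:C%C * a i j + (1 - q)%:C%C * b i j)) ->
  (forall u L, (forall n, S (u n)) ->
    (forall i j, ccvg (fun n => u n i j) (L i j)) -> S L) ->
  (forall a i j, S a -> `|a i j| <= B%:C%C) ->
  (forall a, S a -> op_hermitian a) -> op_hermitian p ->
  (forall a, S a -> ~ psd (op_sub p a)) ->
  exists2 M, effect M & exists2 d : R, 0 < d & forall a, S a ->
    complex.Re (op_trace (op_mul M p)) + d <= complex.Re (op_trace (op_mul M a)).
Proof.
move=> [a0 Sa0] Scvx Scl SB Sh ph nS.
have psd0 : psd (fun _ _ : K => 0 : C).
  move=> psi; rewrite big1// => i _; rewrite big1// => j _.
  by rewrite mulr0 mul0r.
have unemb_cvg u x : vcvg u x -> forall i j, ccvg (fun n => unemb (u n) i j) (unemb x i j).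
  by move=> ux i j; split; exact: ux.
have unemb_cvx (q : R) x y : unemb (fun t => q * x t + (1 - q) * y t) =
    fun i j => q%:C%C * unemb x i j + (1 - q)%:C%C * unemb y i j.
  apply/funext => i; apply/funext => j; apply: eq_Re_Im.
    by rewrite [RHS]cReD !Re_real_mul.
  by rewrite [RHS]cImD !cImM /= !mul0r !addr0.
have [||||||||N [d [d0 Nd]]] := @separation R _ (fun x => S (unemb x))
    (fun x => psd (unemb x)) B (emb p).
- by exists (emb a0); rewrite embK.
- by exists (emb (fun _ _ => 0)); rewrite embK.
- by move=> x y Sx Sy q q01; rewrite unemb_cvx; exact: Scvx.
- move=> x y Px Py q /andP[q0 q1]; rewrite unemb_cvx.
  by apply: psdD; apply: psdZ => //; rewrite ler0c// subr_ge0.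
- by move=> u x uS /unemb_cvg; apply: Scl.
- move=> u x uP /unemb_cvg ux psi.
  apply: (@ccvg_ge0 _ (fun n => qform (unemb (u n)) psi psi)) => [|n]; last exact: uP.
  apply: ccvg_sum => i; apply: ccvg_sum => j; rewrite mulrAC.
  under eq_fun do rewrite mulrAC.
  exact: ccvg_mull.
- move=> x [[i j] []] Sx; rewrite -lecR; apply: le_trans (SB _ i j Sx).
    exact: (Re_le_norm (unemb x i j)).
  exact: (Im_le_norm (unemb x i j)).
- move=> a b Sa Pb pab; apply: (nS _ Sa).
  suff -> : op_sub p (unemb a) = unemb b by [].
  apply/funext => i; apply/funext => j; rewrite /op_sub -[p]embK pab.
  by rewrite /unemb; simpc; rewrite addrC addKr addrC addKr.
pose H := hermitian_part (unemb N).
have Hdot A : op_hermitian A -> op_trace (op_mul H A) = (dot N (emb A))%:C%C.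
  exact: trace_hermitian_part.
have Nd0 a : S a -> dot N (emb p) + d <= dot N (emb a).
  have := Nd (emb a) (emb (fun _ _ => 0)); rewrite !embK => /(_ _ psd0) h Sa.
  suff e : dot N (emb (fun _ _ => 0)) = 0 by have := h Sa; rewrite e addr0.
  by apply: big1 => -[[i j] []] _; rewrite /emb /= mulr0.
have NP A : psd A -> 0 <= dot N (emb A).
  move=> pA; rewrite leNgt; apply/negP => lt0.
  (* Were [N] negative on [A], this multiple of [A] would bring [a0 + s A] to exactly the level of
     [p], against the gap [d]. *)
  pose s := (dot N (emb a0) - dot N (emb p)) / - dot N (emb A).
  have s0 : 0 <= s.
    by rewrite divr_ge0 ?oppr_ge0 ?(ltW lt0)//; have := Nd0 _ Sa0; lra.
  have sE : dot N (emb (fun i j => s%:C%C * A i j)) = s * dot N (emb A).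
    rewrite /dot mulr_sumr; apply: eq_bigr => -[[i j] b] _; rewrite mulrCA /emb /=.
    by case: b; rewrite ?Re_real_mul// cImM /= mul0r addr0.
  have := Nd (emb a0) (emb (fun i j => s%:C%C * A i j)); rewrite !embK sE.
  move=> /(_ Sa0 (psdZ _ pA)); rewrite ler0c => /(_ s0).
  have : s * - dot N (emb A) = dot N (emb a0) - dot N (emb p).
    by rewrite divfK// oppr_eq0 lt_eqF.
  by rewrite mulrN; lra.
have psdH : psd H.
  move=> psi; rewrite -/(qform H psi psi) -op_trace_mul_ket Hdot ?ler0c ?NP//.
    exact: psd_ket.
  exact/psd_hermitian/psd_ket.
(* The second summand dominates [H] by [psd_le_scalar]; the 1 keeps [c] invertible when [H] has
   trace zero. *)
pose c : C := 1 + #|K|%:R * op_trace H.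
have t0 : 0 <= #|K|%:R * op_trace H :> C.
  by rewrite mulr_ge0 ?ler0n// psd_trace_ge0.
have c0 : 0 < c by rewrite ltr_pwDl.
have cE : c = (complex.Re c)%:C%C.
  by apply: eq_Re_Im => //=; rewrite ger0_Im// ltW.
have rc0 : 0 < complex.Re c by rewrite -ltcR -cE.
exists (fun i j => c^-1 * H i j).
  split; first by apply: psdZ => //; rewrite invr_ge0 ltW.
  rewrite /lowner; have -> : op_sub (@op_id R K) (fun i j => c^-1 * H i j) =
      fun i j => c^-1 * (@op_id R K i j +
      op_sub (fun i j => (#|K|%:R * op_trace H) * @op_id R K i j) H i j).
    apply/funext => i; apply/funext => j; rewrite /op_sub.
    have -> : @op_id R K i j + ((#|K|%:R * op_trace H) * @op_id R K i j - H i j) =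
       c * @op_id R K i j - H i j by rewrite /c; ring.
    by rewrite mulrBr mulKf// gt_eqF.
  apply: psdZ; first by rewrite invr_ge0 ltW.
  apply: psdD; last exact: psd_le_scalar.
  move=> psi; rewrite -/(qform _ psi psi) -op_trace_mul_ket op_trace_id.
  exact/psd_trace_ge0/psd_ket.
exists ((complex.Re c)^-1 * d); first by rewrite mulr_gt0 ?invr_gt0.
move=> a Sa; rewrite !op_trace_scalel !Hdot //; last exact: Sh.
rewrite cE -fmorphV -!rmorphM /= -mulrDr ler_pM2l ?invr_gt0//.
exact: Nd0.
Qed.

End OperatorSeparation.

(** * Choi matrices and adjoints *)

Section SuperOperators.
Variables (R : realType) (I : finType).
Local Notation C := R[i].
Implicit Types (G H : SuperOp R I) (rho M : Op R I).

Definition matrix_unit (a b : I) : Op R I :=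
  fun i j => (if i == a then 1 else 0) * (if j == b then 1 else 0).

(** In each pair the output index comes first and the copy of the input index second, matching the
    factor order of [so_ext_anc]. *)
Definition choi G : Op R (I * I)%type :=
  fun x y => G (matrix_unit x.2 y.2) x.1 y.1.

Lemma op_funext (J : finType) (A B : Op R J) : (forall i j, A i j = B i j) -> A = B.
Proof. by move=> AB; apply/funext => i; apply/funext => j. Qed.

Lemma so_linear_sum G (K : finType) (c : K -> C) (X : K -> Op R I) : so_linear G ->
  G (fun i j => \sum_k c k * X k i j) = fun i j => \sum_k c k * G (X k) i j.
Proof.
move=> lG.
have G0 : G (fun _ _ => 0) = fun _ _ => 0.
  have := lG 1 (fun _ _ => 0) (fun _ _ => 0).
  under [X in G X]op_funext do rewrite mulr0 addr0.
  move=> h; apply: op_funext => i j; have := congr1 (fun A => A i j) h => /=.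
  by rewrite mul1r => /eqP; rewrite addrC -subr_eq subrr => /eqP.
elim: (index_enum K) => [|k r IH].
  under [X in G X]op_funext do rewrite big_nil.
  by rewrite G0; apply: op_funext => i j; rewrite big_nil.
under [X in G X]op_funext do rewrite big_cons.
by rewrite lG IH; apply: op_funext => i j; rewrite big_cons.
Qed.

Lemma so_linearZ G (c : C) rho : so_linear G ->
  G (fun i j => c * rho i j) = fun i j => c * G rho i j.
Proof.
move=> lG; have := @so_linear_sum G unit (fun=> c) (fun=> rho) lG.
under [X in G X]op_funext do rewrite (big_pred1 tt)//.
by move=> ->; apply: op_funext => i j; rewrite (big_pred1 tt).
Qed.

Lemma so_linear_choi G rho i j : so_linear G ->
  G rho i j = \sum_(p : I * I) rho p.1 p.2 * choi G (i, p.1) (j, p.2).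
Proof.
move=> lG.
have {1}-> : rho = fun i j => \sum_(p : I * I) rho p.1 p.2 * matrix_unit p.1 p.2 i j.
  apply: op_funext => k l.
  rewrite -(pair_bigA _ (fun a b => rho a b * matrix_unit a b k l))/=.
  rewrite (bigD1 k)//= [X in _ + X]big1 ?addr0; last first.
    move=> a ak; rewrite big1// => b _; rewrite /matrix_unit [k == a]eq_sym (negbTE ak).
    by rewrite mul0r mulr0.
  rewrite (bigD1 l)//= big1 ?addr0; last first.
    move=> b bl; rewrite /matrix_unit [l == b]eq_sym (negbTE bl).
    by rewrite !mulr0.
  by rewrite /matrix_unit !eqxx !mulr1.
by rewrite (so_linear_sum _ _ lG).
Qed.

Lemma eq_so_choi G H : so_linear G -> so_linear H -> choi G = choi H -> G = H.
Proof.
move=> lG lH GH; apply/funext => rho; apply: op_funext => i j.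
by rewrite !so_linear_choi// GH.
Qed.

(** The Choi matrix is the image of the unnormalised maximally entangled vector [w] under [G]
    tensored with the identity. *)
Lemma cp_psd_choi G : completely_positive G -> psd (choi G).
Proof.
move=> cpG.
pose w (x : I * I) : C := if x.1 == x.2 then 1 else 0.
have := cpG I (ket w) (psd_ket w); congr psd; apply: op_funext => x y.
rewrite /so_ext_anc /choi /ket /w /matrix_unit /=; congr (G _ _ _); apply: op_funext => i j.
by congr (_ * _); case: eqP => _; rewrite ?conjC1 ?conjC0.
Qed.

(* A factorisation [choi G = sum_k v_k v_k^*] is a Kraus decomposition of [G]. *)
Lemma psd_choi_cp G : so_linear G -> psd (choi G) -> completely_positive G.
Proof.
move=> lG /psd_decomp[v vE] A rho prho psi.
(* The adjoint of the [k]-th Kraus operator, tensored with the identity, applied to [psi]. *)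
pose phi k (s : I * A) : C := \sum_i (v k (i, s.1))^* * psi (i, s.2).
suff -> : \sum_x \sum_y (psi x)^* * so_ext_anc G rho x y * psi y =
    \sum_k qform rho (phi k) (phi k) by apply: sumr_ge0 => k _; exact: prho.
transitivity (\sum_x \sum_y \sum_(p : I * I) \sum_k (psi x)^* *
    rho (p.1, x.2) (p.2, y.2) * (v k (x.1, p.1) * (v k (y.1, p.2))^*) * psi y).
  apply: eq_bigr => x _; apply: eq_bigr => y _.
  rewrite /so_ext_anc so_linear_choi// mulr_sumr mulr_suml.
  apply: eq_bigr => p _; rewrite vE mulr_sumr mulr_sumr mulr_suml.
  by apply: eq_bigr => k _; rewrite !mulrA.
have -> : \sum_x \sum_y \sum_(p : I * I) \sum_k (psi x)^* *
    rho (p.1, x.2) (p.2, y.2) * (v k (x.1, p.1) * (v k (y.1, p.2))^*) * psi y =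
  \sum_k \sum_x \sum_y \sum_(p : I * I) (psi x)^* *
    rho (p.1, x.2) (p.2, y.2) * (v k (x.1, p.1) * (v k (y.1, p.2))^*) * psi y.
  rewrite [RHS]exchange_big/=; apply: eq_bigr => x _.
  rewrite [RHS]exchange_big/=; apply: eq_bigr => y _.
  by rewrite [RHS]exchange_big.
apply: eq_bigr => k _.
transitivity (\sum_(r : I * A) \sum_(s : I * A) \sum_(q : I * I)
   (v k (q.1, r.1) * (psi (q.1, r.2))^*) * rho r s *
   ((v k (q.2, s.1))^* * psi (q.2, s.2))); last first.
  apply: eq_bigr => r _; apply: eq_bigr => s _.
  rewrite /phi conj_sum !mulr_suml.
  rewrite -(pair_bigA _ (fun i j => (v k (i, r.1) * (psi (i, r.2))^*) * rho r s *
   ((v k (j, s.1))^* * psi (j, s.2))))/=.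
  apply: eq_bigr => i _; rewrite mulr_sumr; apply: eq_bigr => j _.
  by rewrite rmorphM/= conjCK.
rewrite !pair_bigA/=.
(* Swaps the input indices with the output indices and leaves the ancilla indices in place; this
   matches the two expansions. *)
pose h (t : (I * A) * (I * A) * (I * I)) : (I * A) * (I * A) * (I * I) :=
  ((t.2.1, t.1.1.2), (t.2.2, t.1.2.2), (t.1.1.1, t.1.2.1)).
have hK : involutive h by move=> [[[i a] [j b]] [c d]].
rewrite (reindex_inj (inv_inj hK))/=; apply: eq_bigr => -[[[i a] [j b]] [c d]] _ /=.
ring.
Qed.

Lemma so_linear_sub G H : so_linear G -> so_linear H -> so_linear (so_sub G H).
Proof.
move=> lG lH a x y; rewrite /so_sub lG lH; apply: op_funext => i j; ring.
Qed.

Lemma choi_sub G H : choi (so_sub G H) = op_sub (choi G) (choi H).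
Proof. by []. Qed.

Lemma so_leP G H : so_linear G -> so_linear H ->
  so_le G H <-> psd (op_sub (choi H) (choi G)).
Proof.
move=> lG lH; rewrite -choi_sub; split; first exact: cp_psd_choi.
exact/psd_choi_cp/so_linear_sub.
Qed.

Lemma so_le_refl G : so_le G G.
Proof.
move=> A rho _ psi; rewrite big1// => x _; rewrite big1// => y _.
by rewrite /so_ext_anc /so_sub subrr mulr0 mul0r.
Qed.

Lemma so_le_trans G H L : so_le G H -> so_le H L -> so_le G L.
Proof.
move=> GH HL A rho prho; have := psdD (GH A rho prho) (HL A rho prho).
congr psd; apply: op_funext => x y; rewrite /so_ext_anc /so_sub.
by rewrite addrC addrA subrK.
Qed.

Lemma trace_choi G : op_trace (choi G) = \sum_a op_trace (G (matrix_unit a a)).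
Proof.
rewrite /op_trace -(pair_bigA _ (fun i a => choi G (i, a) (i, a)))/=.
by rewrite exchange_big.
Qed.

Lemma psd_matrix_unit a : psd (matrix_unit a a).
Proof.
have := psd_ket (fun i : I => if i == a then 1 else 0 : C); congr psd.
by apply: op_funext => i j; rewrite /ket /matrix_unit; case: (j == a); rewrite ?conjC1 ?conjC0.
Qed.

Lemma trace_matrix_unit a : op_trace (matrix_unit a a) = 1.
Proof.
rewrite /op_trace (bigD1 a)//= big1 ?addr0 /matrix_unit ?eqxx ?mulr1//.
by move=> i /negbTE ->; rewrite mul0r.
Qed.

(** The trace of a Choi matrix sums the output traces over the basis states, each at most 1. This is
    the boundedness that [separation] asks for. *)
Lemma choi_bound G : completely_positive G -> trace_nonincreasing G ->
  forall x y, `|choi G x y| <= #|I|%:R.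
Proof.
move=> cpG tG x y; apply: le_trans (psd_norm_le_trace x y (cp_psd_choi cpG)) _.
rewrite trace_choi -sum1_card natr_sum; apply: ler_sum => a _.
by apply: le_trans (tG _ (psd_matrix_unit a)) _; rewrite trace_matrix_unit.
Qed.

Lemma so_le_trace_preserving_eq G H : so_linear G -> so_linear H ->
  trace_preserving G -> trace_preserving H -> so_le G H -> G = H.
Proof.
move=> lG lH tG tH /(so_leP lG lH) pGH; apply: eq_so_choi => //.
apply: op_funext => x y; apply/esym/eqP; rewrite -subr_eq0; apply/eqP.
apply: (psd_trace_eq0 pGH); rewrite op_trace_sub !trace_choi -sumrB.
by rewrite big1// => a _; rewrite tG tH subrr.
Qed.

(** The Heisenberg dual. The indices of the matrix unit are swapped because pairing [X] with the
    unit at [(j, i)] reads off the entry [X i j]. *)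
Definition so_adjoint G M : Op R I :=
  fun i j => op_trace (op_mul M (G (matrix_unit j i))).

Lemma trace_so_adjoint G M rho : so_linear G ->
  op_trace (op_mul (so_adjoint G M) rho) = op_trace (op_mul M (G rho)).
Proof.
move=> lG; rewrite !op_trace_mul.
transitivity (\sum_(p : I * I) \sum_(q : I * I)
   M q.1 q.2 * rho p.1 p.2 * choi G (q.2, p.1) (q.1, p.2)).
  rewrite exchange_big/= pair_bigA/=; apply: eq_bigr => -[i j] _ /=.
  rewrite /so_adjoint op_trace_mul pair_bigA/= mulr_suml.
  by apply: eq_bigr => q _; rewrite mulrAC.
rewrite exchange_big/= [RHS]pair_bigA/=; apply: eq_bigr => -[i j] _ /=.
by rewrite so_linear_choi// mulr_sumr; apply: eq_bigr => p _; rewrite mulrA.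
Qed.

Lemma effect_sub_id M : effect M -> effect (op_sub (@op_id R I) M).
Proof.
move=> [pM lM]; split=> //; rewrite /lowner.
suff -> : op_sub (@op_id R I) (op_sub (@op_id R I) M) = M by [].
by apply: op_funext => i j; rewrite /op_sub opprB addrC subrK.
Qed.

(** Tested on kets: positivity of [G] gives the lower bound; the upper one combines [M] below the
    identity with trace nonincrease. *)
Lemma effect_so_adjoint G M : so_linear G ->
  (forall rho, psd rho -> psd (G rho)) -> trace_nonincreasing G ->
  effect M -> effect (so_adjoint G M).
Proof.
move=> lG pG tG [pM lM]; split=> psi.
  rewrite -/(qform _ psi psi) -op_trace_mul_ket trace_so_adjoint//.
  by apply: op_trace_mul_ge0 => //; exact/pG/psd_ket.
rewrite -/(qform _ psi psi) -op_trace_mul_ket op_trace_subl trace_so_adjoint//.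
rewrite op_trace_id subr_ge0; apply: le_trans (tG _ (psd_ket psi)).
rewrite -subr_ge0 -[op_trace (G _)]op_trace_id -op_trace_subl.
by apply: op_trace_mul_ge0 => //; exact/pG/psd_ket.
Qed.

End SuperOperators.

(** * Cylindric extensions *)

Section Bases.
Implicit Types V W X S : {fset nat}.
Local Open Scope fset_scope.

Lemma tot_of_tot S (f : nat -> bool) n :
  tot (of_tot S f) n = if n \in S then f n else false.
Proof.
rewrite /tot; case: insubP => [q qS qn|/negbTE ->//].
by rewrite ffunE qS qn.
Qed.

Lemma tot_val S (b : bas S) (q : S) : tot b (val q) = b q.
Proof. by rewrite /tot valK. Qed.

Lemma eq_bas S (b c : bas S) : (forall n, n \in S -> tot b n = tot c n) -> b = c.
Proof. by move=> bc; apply/ffunP => q; rewrite -!tot_val bc// fsvalP. Qed.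

(** The basis form of H_X as the tensor product of H_W and H_(X \ W). Unlike [bglue], which
    overwrites a full assignment, it is a bijection from a product when [W] lies in [X]. *)
Definition glue X W (w : bas W) (c : bas (X `\` W)) : bas X :=
  of_tot X (fun n => if n \in W then tot w n else tot c n).
Arguments glue : clear implicits.

Definition unglue X W (x : bas X) : bas W * bas (X `\` W) :=
  (bres W x, bres (X `\` W) x).
Arguments unglue : clear implicits.

Lemma glueK X W : W `<=` X ->
  cancel (fun p => glue X W p.1 p.2) (unglue X W).
Proof.
move=> WX [w c]; congr pair; apply: eq_bas => n; rewrite !tot_of_tot/=.
  by move=> nW; rewrite nW (fsubsetP WX).
by rewrite inE => /andP[/negbTE nW nX]; rewrite nW nX.
Qed.

Lemma unglueK X W : W `<=` X ->
  cancel (unglue X W) (fun p => glue X W p.1 p.2).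
Proof.
move=> WX x; apply: eq_bas => n nX; rewrite !tot_of_tot nX inE nX andbT.
by case: (n \in W).
Qed.

Lemma glue_inj2 X W w w' c c' : W `<=` X ->
  (glue X W w c == glue X W w' c') = (w == w') && (c == c').
Proof.
move=> WX; have /can_inj inj := glueK WX.
apply/eqP/andP => [/(inj (w, c) (w', c'))[-> ->]//|[/eqP -> /eqP -> //]].
Qed.

Lemma bres_glue V W X w c : V `<=` W -> W `<=` X ->
  bres V (glue X W w c) = bres V w.
Proof.
move=> VW WX; apply: eq_bas => n nV; rewrite !tot_of_tot nV.
by have nW := fsubsetP VW _ nV; rewrite nW (fsubsetP WX).
Qed.

Lemma bglue_glue V W X w c (v : bas V) : V `<=` W -> W `<=` X ->
  bglue (glue X W w c) v = glue X W (bglue w v) c.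
Proof.
move=> VW WX; apply: eq_bas => n nX; rewrite !tot_of_tot nX.
case: (boolP (n \in V)) => [nV|_]; first by rewrite (fsubsetP VW).
by case: (n \in W).
Qed.

Lemma bres_id V (v : bas V) : bres V v = v.
Proof. by apply: eq_bas => n nV; rewrite tot_of_tot nV. Qed.

Lemma bglue_id V (v w : bas V) : bglue v w = w.
Proof. by apply: eq_bas => n nV; rewrite tot_of_tot nV. Qed.

(** Rests on the supply of variables being infinite: shifting [V] by a strict upper bound [m] of its
    elements gives a disjoint copy, to serve as the ancilla. *)
Lemma fresh_copy V : exists2 W : {fset nat}, V `<=` W &
  exists k : bas V -> bas (W `\` V), bijective k.
Proof.
have [m mV] : exists m, forall n, n \in V -> (n < m)%N.
  exists (\max_(n <- V) n).+1 => n nV; rewrite ltnS.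
  exact: (@leq_bigmax_seq _ (enum_fset V) xpredT id n nV).
pose V' := [fset (n + m)%N | n in V].
exists (V `|` V'); first exact: fsubsetUl.
have V'E n : n \in (V `|` V') `\` V -> exists2 k, k \in V & n = (k + m)%N.
  by rewrite !inE => /andP[/negbTE ->] /imfsetP[k /= kV ->]; exists k.
have V'I n : n \in V -> (n + m)%N \in (V `|` V') `\` V.
  move=> nV; rewrite !inE.
  have -> : (n + m)%N \in V' by apply/imfsetP; exists n.
  by rewrite orbT andbT; apply/negP => /mV; rewrite ltnNge leq_addl.
exists (fun a => of_tot _ (fun n => tot a (n - m)%N)).
exists (fun b => of_tot _ (fun n => tot b (n + m)%N)) => b; apply: eq_bas => n.
  by move=> nV; rewrite !tot_of_tot nV V'I// addnK.
by move=> nV; rewrite !tot_of_tot nV; have [k kV ->] := V'E _ nV; rewrite addnK kV.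
Qed.

End Bases.
Arguments glue : clear implicits.
Arguments unglue : clear implicits.

Section Extensions.
Variable R : realType.
Local Notation C := R[i].
Implicit Types V W X : {fset nat}.

Lemma sum_pair (I J : finType) (F : I * J -> C) : \sum_p F p = \sum_i \sum_j F (i, j).
Proof. by rewrite pair_bigA; apply: eq_bigr => -[]. Qed.

Lemma psd_comp_bij (I J : finType) (f : I -> J) (A : Op R J) : bijective f ->
  psd A -> psd (fun i j => A (f i) (f j)).
Proof.
move=> bf pA psi; have [g fK gK] := bf.
have := pA (fun k => psi (g k)); congr (0 <= _).
rewrite (reindex f) /=; last exact: onW_bij.
apply: eq_bigr => i _; rewrite (reindex f) /=; last exact: onW_bij.
by apply: eq_bigr => j _; rewrite !fK.
Qed.

Lemma psd_of_comp_bij (I J : finType) (f : I -> J) (A : Op R J) : bijective f ->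
  psd (fun i j => A (f i) (f j)) -> psd A.
Proof.
move=> [g fK gK] pA; have bg : bijective g by exists f.
by have := psd_comp_bij bg pA; congr psd; apply: op_funext => i j; rewrite !gK.
Qed.

Lemma op_trace_comp_bij (I J : finType) (f : I -> J) (A : Op R J) : bijective f ->
  op_trace (fun i j => A (f i) (f j)) = op_trace A.
Proof. by move=> bf; rewrite [RHS](reindex f)//; exact: onW_bij. Qed.

Lemma op_trace_mul_comp_bij (I J : finType) (f : I -> J) (A B : Op R J) : bijective f ->
  op_trace (op_mul (fun i j => A (f i) (f j)) (fun i j => B (f i) (f j))) =
  op_trace (op_mul A B).
Proof.
move=> bf; rewrite -(op_trace_comp_bij (op_mul A B) bf); congr op_trace.
by apply: op_funext => i j; rewrite /op_mul [RHS](reindex f)//; exact: onW_bij.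
Qed.

Section Split.
Variables (W X : {fset nat}).
Hypothesis WX : (W `<=` X)%fset.

Local Notation gl := (fun p : bas W * bas (X `\` W)%fset => glue X W p.1 p.2).

Lemma bij_glue : bijective gl.
Proof. by exists (unglue X W); [exact: glueK | exact: unglueK]. Qed.

Lemma sum_glue (F : bas X -> C) : \sum_x F x = \sum_w \sum_c F (glue X W w c).
Proof. by rewrite pair_bigA (reindex gl)//=; apply: onW_bij; exact: bij_glue. Qed.

Lemma op_ext_glue (M : Op R (bas W)) w w' c c' :
  op_ext M (glue X W w c) (glue X W w' c') = if c == c' then M w w' else 0.
Proof.
rewrite /op_ext !bres_glue// !bres_id; congr (if _ then _ else _).
apply/forallP/eqP => [h|-> q]; last first.
  by apply/implyP => /negbTE qW; rewrite !ffunE qW.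
apply: eq_bas => n; rewrite inE => /andP[nW nX].
by have /implyP/(_ nW)/eqP := h [` nX]%fset; rewrite !ffunE /= (negbTE nW).
Qed.

Lemma eq_op_glue (A B : Op R (bas X)) :
  (forall w c w' c', A (glue X W w c) (glue X W w' c') =
    B (glue X W w c) (glue X W w' c')) -> A = B.
Proof.
move=> AB; apply: op_funext => x y; rewrite -[x](unglueK WX) -[y](unglueK WX).
exact: AB.
Qed.

Lemma op_ext_id : op_ext (@op_id R (bas W)) = @op_id R (bas X).
Proof.
apply: eq_op_glue => w c w' c'; rewrite op_ext_glue /op_id glue_inj2//.
by case: (c == c'); rewrite ?andbT ?andbF.
Qed.

Lemma op_ext_sub (A B : Op R (bas W)) :
  @op_ext R W X (op_sub A B) = op_sub (op_ext A) (op_ext B).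
Proof.
apply: op_funext => x y; rewrite /op_sub /op_ext; case: ifP => // _.
by rewrite subrr.
Qed.

Lemma psd_op_ext (M : Op R (bas W)) : psd M -> psd (@op_ext R W X M).
Proof.
move=> pM; apply: (psd_of_comp_bij bij_glue) => psi /=.
have -> : \sum_p \sum_q (psi p)^* *
    op_ext M (glue X W p.1 p.2) (glue X W q.1 q.2) * psi q =
    \sum_c qform M (fun w => psi (w, c)) (fun w => psi (w, c)).
  rewrite sum_pair exchange_big/=; apply: eq_bigr => c _; apply: eq_bigr => w _.
  rewrite sum_pair.
  apply: eq_bigr => w' _; rewrite (bigD1 c)//= big1 ?addr0 => [|c' cc'].
    by rewrite op_ext_glue eqxx.
  by rewrite op_ext_glue eq_sym (negbTE cc') mulr0 mul0r.
by apply: sumr_ge0 => c _; exact: pM.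
Qed.

Lemma effect_op_ext (M : Op R (bas W)) : effect M -> effect (@op_ext R W X M).
Proof.
move=> [pM lM]; split; first exact: psd_op_ext.
by rewrite /lowner -op_ext_id -op_ext_sub; exact: psd_op_ext.
Qed.

Definition partial_trace (rho : Op R (bas X)) : Op R (bas W) :=
  fun w w' => \sum_c rho (glue X W w c) (glue X W w' c).

Lemma trace_partial_trace rho : op_trace (partial_trace rho) = op_trace rho.
Proof. by rewrite /op_trace [RHS]sum_glue. Qed.

Lemma trace_op_ext (M : Op R (bas W)) rho :
  op_trace (op_mul (op_ext M) rho) = op_trace (op_mul M (partial_trace rho)).
Proof.
rewrite !op_trace_mul sum_glue; apply: eq_bigr => w _.
transitivity (\sum_c \sum_w' M w w' * rho (glue X W w' c) (glue X W w c)).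
  apply: eq_bigr => c _; rewrite sum_glue; apply: eq_bigr => w' _.
  rewrite (bigD1 c)//= big1 ?addr0 => [|c' cc'].
    by rewrite op_ext_glue eqxx.
  by rewrite op_ext_glue eq_sym (negbTE cc') mul0r.
by rewrite exchange_big/=; apply: eq_bigr => w' _; rewrite mulr_sumr.
Qed.

Lemma psd_partial_trace rho : psd rho -> psd (partial_trace rho).
Proof.
move=> prho psi; rewrite -/(qform _ psi psi) -op_trace_mul_ket op_trace_mulC.
rewrite -trace_op_ext; apply: op_trace_mul_ge0 => //.
exact/psd_op_ext/psd_ket.
Qed.

(** Cylindric extension is ancilla extension with [bas (X \ W)] as ancilla, so complete positivity
    applies to it. *)
Lemma so_ext_glue (G : SuperOp R (bas W)) (rho : Op R (bas X)) p q :
  so_ext G rho (gl p) (gl q) =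
  so_ext_anc G (fun p q => rho (gl p) (gl q)) p q.
Proof.
rewrite /so_ext /so_ext_anc !bres_glue// !bres_id.
congr (G _ _ _); apply: op_funext => i j.
by rewrite !bglue_glue// !bglue_id.
Qed.

Lemma psd_so_ext (G : SuperOp R (bas W)) (rho : Op R (bas X)) :
  completely_positive G -> psd rho -> psd (so_ext G rho).
Proof.
move=> cpG prho; apply: (psd_of_comp_bij bij_glue).
have := cpG _ _ (psd_comp_bij bij_glue prho); congr psd; apply: op_funext => p q.
by rewrite so_ext_glue.
Qed.

End Split.
Arguments partial_trace W {X} rho.

Lemma so_linear_ext V X (G : SuperOp R (bas V)) :
  so_linear G -> so_linear (@so_ext R V X G).
Proof. by move=> lG a x y; apply: op_funext => i j; rewrite /so_ext lG. Qed.

(** [G] does not touch the variables outside [W], so by linearity the sum over them passes through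
    it. *)
Lemma partial_trace_so_ext V W X (G : SuperOp R (bas V)) (rho : Op R (bas X)) :
  so_linear G -> (V `<=` W)%fset -> (W `<=` X)%fset ->
  partial_trace W (so_ext G rho) = so_ext G (partial_trace W rho).
Proof.
move=> lG VW WX; apply: op_funext => w w'; rewrite /partial_trace /so_ext.
under eq_bigr do rewrite !bres_glue//.
set g := (X in G X).
have -> : g = fun i j => \sum_(c : bas (X `\` W)%fset) 1 *
    rho (glue X W (bglue w i) c) (glue X W (bglue w' j) c).
  by apply: op_funext => i j; apply: eq_bigr => c _; rewrite mul1r.
rewrite (so_linear_sum (fun=> 1)
  (fun c i j => rho (glue X W (bglue w i) c) (glue X W (bglue w' j) c)) lG).
apply: eq_bigr => c _; rewrite mul1r; congr (G _ _ _); apply: op_funext => i j.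
by rewrite !bglue_glue.
Qed.

Lemma so_ext_id V (G : SuperOp R (bas V)) : @so_ext R V V G = G.
Proof.
apply/funext => rho; apply: op_funext => i j; rewrite /so_ext !bres_id.
by congr (G _ _ _); apply: op_funext => k l; rewrite !bglue_id.
Qed.

Lemma trace_nonincreasing_ext V X (G : SuperOp R (bas V)) :
  so_linear G -> (V `<=` X)%fset ->
  trace_nonincreasing G -> trace_nonincreasing (@so_ext R V X G).
Proof.
move=> lG VX tG rho prho.
rewrite -(trace_partial_trace VX) -[leRHS](trace_partial_trace VX).
rewrite partial_trace_so_ext// so_ext_id; apply: tG.
exact: psd_partial_trace.
Qed.

(** An adjoint formed on [W] is a correct precondition on every larger system, as the quantification
    over [X] in [models_tot] and [models_par] demands. *)
Lemma trace_so_adjoint_ext V W X (G : SuperOp R (bas V)) (M : Op R (bas W))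
    (rho : Op R (bas X)) :
  so_linear G -> (V `<=` W)%fset -> (W `<=` X)%fset ->
  op_trace (op_mul (op_ext (so_adjoint (so_ext G) M)) rho) =
  op_trace (op_mul (op_ext M) (so_ext G rho)).
Proof.
move=> lG VW WX; rewrite !trace_op_ext// trace_so_adjoint; last exact: so_linear_ext.
by rewrite partial_trace_so_ext.
Qed.

End Extensions.

(** * Expectations and refinement *)

(** The side conditions exclude the default value 0 that [inf] takes on empty or unbounded sets. *)
Lemma inf_le_shift (R : realType) (A B : set R) (c : R) : B !=set0 -> has_lbound A ->
  (forall b, B b -> exists2 a, A a & a <= b + c) -> inf A <= inf B + c.
Proof.
move=> B0 Al AB; rewrite -lerBlDr; apply: lb_le_inf => // b /AB[a Aa ab].
by rewrite lerBlDr; apply: le_trans ab; exact: ge_inf.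
Qed.

Section Expectation.
Variables (R : realType) (W X : {fset nat}).
Hypothesis WX : (W `<=` X)%fset.
Local Notation tr A := (complex.Re (op_trace A)).
Implicit Types (rho sigma tau : Op R (bas X)) (M : Op R (bas W)).
Implicit Types Psi : set (Op R (bas W)).

Lemma Exp_dem_image rho (T : Type) (S : set T) (f : T -> Op R (bas W)) :
  S !=set0 ->
  Exp_dem rho (f @` S) = inf [set tr (op_mul (op_ext (f e)) rho) | e in S].
Proof.
move=> [e Se]; rewrite /Exp_dem; case: asboolP => [f0|_].
  by have : (f @` S) (f e) by [exists e]; rewrite f0.
by rewrite image_comp.
Qed.

Lemma Exp_dem_set1 rho M : Exp_dem rho [set M] = tr (op_mul (op_ext M) rho).
Proof.
rewrite -(image_set1 id M) Exp_dem_image; last by exists M.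
by rewrite image_set1 inf1.
Qed.

Lemma effect_trace_ge0 M rho : effect M -> psd rho ->
  0 <= tr (op_mul (op_ext M) rho).
Proof.
move=> eM prho; apply/ge0_Re/op_trace_mul_ge0 => //.
by have [] := effect_op_ext WX eM.
Qed.

Lemma effect_trace_le M rho : effect M -> psd rho ->
  tr (op_mul (op_ext M) rho) <= tr rho.
Proof.
move=> eM prho; rewrite -[op_trace rho]op_trace_id -subr_ge0 -cReB.
rewrite -op_trace_subl; apply/ge0_Re/op_trace_mul_ge0 => //.
by have [] := effect_op_ext WX eM.
Qed.

Lemma Exp_dem_lbound rho Psi : Psi `<=` @effect R (bas W) -> psd rho ->
  lbound [set tr (op_mul (op_ext M) rho) | M in Psi] 0.
Proof. by move=> ePsi prho _ [M /ePsi eM <-]; exact: effect_trace_ge0. Qed.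

Lemma Exp_dem_ge0 rho Psi : Psi `<=` @effect R (bas W) -> psd rho ->
  0 <= Exp_dem rho Psi.
Proof.
move=> ePsi prho; rewrite /Exp_dem; case: asboolP => [_|/eqP/set0P[M PM]].
  exact/ge0_Re/psd_trace_ge0.
apply: lb_le_inf; last exact: Exp_dem_lbound.
by exists (tr (op_mul (op_ext M) rho)), M.
Qed.

Lemma Exp_dem_mono sigma tau Psi : Psi `<=` @effect R (bas W) ->
  psd sigma -> lowner sigma tau -> Exp_dem sigma Psi <= Exp_dem tau Psi.
Proof.
move=> ePsi ps st; rewrite /Exp_dem; case: asboolP => [_|/eqP/set0P[M PM]].
  by rewrite -subr_ge0 -cReB -op_trace_sub; exact/ge0_Re/psd_trace_ge0.
rewrite -[leRHS]addr0; apply: inf_le_shift.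
- by exists (tr (op_mul (op_ext M) tau)), M.
- by exists 0; exact: Exp_dem_lbound.
move=> _ [N PN <-]; exists (tr (op_mul (op_ext N) sigma)); first by exists N.
rewrite addr0 -subr_ge0 -cReB -op_trace_subr.
exact: effect_trace_ge0 (ePsi _ PN) st.
Qed.

(** Expectation minus trace is the infimum of minus the trace against [1 - M]. As [1 - M] is
    positive, it decreases when the state grows, which reverses the order for partial
    correctness. *)
Lemma Exp_dem_deficit sigma tau Psi : Psi `<=` @effect R (bas W) ->
  psd tau -> lowner sigma tau ->
  Exp_dem tau Psi - tr tau <= Exp_dem sigma Psi - tr sigma.
Proof.
move=> ePsi pt st; rewrite lerBlDr -addrA /Exp_dem.
case: asboolP => [_|/eqP/set0P[M PM]]; first by lra.
apply: inf_le_shift.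
- by exists (tr (op_mul (op_ext M) sigma)), M.
- by exists 0; exact: Exp_dem_lbound.
move=> _ [N PN <-]; exists (tr (op_mul (op_ext N) tau)); first by exists N.
have := effect_trace_le (ePsi _ PN) st; rewrite op_trace_subr op_trace_sub !cReB.
lra.
Qed.

End Expectation.

Section Refinement.
Variables (R : realType) (V : {fset nat}).
Local Notation C := R[i].
Local Notation tr A := (complex.Re (op_trace A)).
Implicit Types (E F S : set (SuperOp R (bas V))).

(** * From the orders on programs to refinement *)

Lemma psd_DProg_ext (X : {fset nat}) (e : SuperOp R (bas V)) (rho : Op R (bas X)) :
  (V `<=` X)%fset -> DProg e -> psd rho -> psd (so_ext e rho).
Proof. by move=> VX [_ [cp _]]; exact: psd_so_ext. Qed.

Lemma lowner_so_ext (X : {fset nat}) (e f : SuperOp R (bas V)) (rho : Op R (bas X)) :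
  (V `<=` X)%fset -> so_le e f -> psd rho -> lowner (so_ext e rho) (so_ext f rho).
Proof. by move=> VX ef prho; exact: (psd_so_ext VX ef prho). Qed.

Lemma trace_DProg_ext (X : {fset nat}) (e : SuperOp R (bas V)) (rho : Op R (bas X)) :
  (V `<=` X)%fset -> DProg e -> psd rho -> tr (so_ext e rho) <= tr rho.
Proof.
move=> VX [le [_ te]] prho; apply: le_Re.
exact: (trace_nonincreasing_ext le VX te).
Qed.

Lemma le_S_ref_T E F : E `<=` @DProg R V -> F !=set0 -> le_S E F -> ref_T E F.
Proof.
move=> ED [f0 Ff0] EF W Theta Psi _ ePsi mE X VWX rho drho.
have [VX WX] : (V `<=` X)%fset /\ (W `<=` X)%fset by move: VWX; rewrite fsubUset => /andP.
have [prho _] := drho.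
apply: le_trans (mE X VWX rho drho) _; rewrite -[leRHS]addr0; apply: inf_le_shift.
- by exists (Exp_dem (so_ext f0 rho) Psi), (so_ext f0 rho) => //; exists f0.
- exists 0 => _ [_ [e Ee <-] <-]; apply: Exp_dem_ge0 => //.
  exact: psd_DProg_ext (ED _ Ee) prho.
move=> _ [_ [f Ff <-] <-]; have [e Ee ef] := EF _ Ff.
exists (Exp_dem (so_ext e rho) Psi); first by exists (so_ext e rho) => //; exists e.
rewrite addr0; apply: Exp_dem_mono => //; first exact: psd_DProg_ext (ED _ Ee) prho.
exact: lowner_so_ext.
Qed.

Lemma le_H_ref_P E F : E `<=` @DProg R V -> F !=set0 -> le_H F E -> ref_P E F.
Proof.
move=> ED [f0 Ff0] FE W Theta Psi _ ePsi mE X VWX rho drho.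
have [VX WX] : (V `<=` X)%fset /\ (W `<=` X)%fset by move: VWX; rewrite fsubUset => /andP.
have [prho _] := drho.
apply: le_trans (mE X VWX rho drho) _; rewrite -[leRHS]addr0; apply: inf_le_shift.
- exists (Exp_dem (so_ext f0 rho) Psi + tr rho - tr (so_ext f0 rho)).
  by exists (so_ext f0 rho) => //; exists f0.
- exists 0 => _ [_ [e Ee <-] <-].
  have := Exp_dem_ge0 WX ePsi (psd_DProg_ext VX (ED _ Ee) prho).
  have := trace_DProg_ext VX (ED _ Ee) prho; lra.
move=> _ [_ [f Ff <-] <-]; have [e Ee fe] := FE _ Ff.
exists (Exp_dem (so_ext e rho) Psi + tr rho - tr (so_ext e rho)).
  by exists (so_ext e rho) => //; exists e.
have := Exp_dem_deficit WX ePsi (psd_DProg_ext VX (ED _ Ee) prho)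
  (lowner_so_ext VX fe prho).
lra.
Qed.

(** * From refinement to the orders: distinguishing tests *)

Lemma ccvg_unique (u : nat -> C) (z w : C) : ccvg u z -> ccvg u w -> z = w.
Proof.
by move=> [zR zI] [wR wI]; apply: eq_Re_Im; [exact: cvg_unique wR | exact: cvg_unique wI].
Qed.

(** Finitely many Choi entries control every input: the super-operator decoded from [L] is the
    pointwise limit of the [e n], to which [so_closed] applies. *)
Lemma choi_closed S (e : nat -> SuperOp R (bas V)) L : S `<=` @DProg R V ->
  so_closed S -> (forall n, S (e n)) ->
  (forall x y, ccvg (fun n => choi (e n) x y) (L x y)) ->
  exists2 g, S g & choi g = L.
Proof.
move=> SD Scl Se eL.
pose g : SuperOp R (bas V) := fun rho i j =>
  \sum_(p : bas V * bas V) rho p.1 p.2 * L (i, p.1) (j, p.2).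
have eg rho i j : ccvg (fun n => e n rho i j) (g rho i j).
  have -> : (fun n => e n rho i j) = fun n =>
      \sum_(p : bas V * bas V) rho p.1 p.2 * choi (e n) (i, p.1) (j, p.2).
    by apply/funext => n; rewrite so_linear_choi//; have [] := SD _ (Se n).
  by apply: ccvg_sum => p; exact: ccvg_mull.
exists g; first exact: (Scl e).
by apply: op_funext => x y; apply: ccvg_unique (eL x y); exact: eg.
Qed.

(** The sign [c] treats both orders at once: 1 when no [e] lies below [f], -1 when none lies
    above. *)
Lemma choi_separation S f (c : R) : NProg S -> DProg f -> c ^+ 2 = 1 ->
  (forall e, S e -> ~ psd (fun x y => c%:C%C * (choi f x y - choi e x y))) ->
  exists2 N, effect N & exists2 d : R, 0 < d & forall e, S e ->
    c * tr (op_mul N (choi f)) + d <= c * tr (op_mul N (choi e)).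
Proof.
move=> [[e0 Se0] [SD [Scvx Scl]]] [_ [fcp _]] c2 nS.
have cc (z : C) : c%:C%C * (c%:C%C * z) = z.
  by rewrite mulrA -rmorphM/= -expr2 c2 mul1r.
have cJ : (c%:C%C)^* = c%:C%C :> C by apply: eq_Re_Im; rewrite /= ?oppr0.
have nc : `|c%:C%C| = 1 :> C.
  apply/eqP; rewrite -(@eqrXn2 _ 2)// ?normr_ge0 ?ler01// normCK cJ.
  by rewrite -rmorphM/= -expr2 c2 expr1n.
have herm (A : Op R (bas V * bas V)%type) : psd A ->
    op_hermitian (fun x y => c%:C%C * A x y).
  by move=> pA x y; rewrite rmorphM/= cJ (psd_hermitian pA x y).
have pch e : S e -> psd (choi e) by move=> /SD[_ [cp _]]; exact: cp_psd_choi.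
have [|||||||N eN [d d0 Nd]] := @psd_separation R (bas V * bas V)%type
    [set a | exists2 e, S e & a = fun x y => c%:C%C * choi e x y]
    (fun x y => c%:C%C * choi f x y) #|bas V|%:R.
- by exists (fun x y => c%:C%C * choi e0 x y), e0.
- move=> _ _ [e Se ->] [e' Se' ->] q q01.
  exists (fun rho i j => q%:C%C * e rho i j + (1 - q)%:C%C * e' rho i j).
    exact: Scvx.
  by apply: op_funext => x y; rewrite /choi mulrDr !(mulrCA c%:C%C).
- move=> u L uS uL; have /choice[e He] n : exists e, S e /\
      u n = fun x y => c%:C%C * choi e x y.
    by have [e] := uS n; exists e.
  have [||g Sg gL] := @choi_closed S e (fun x y => c%:C%C * L x y) SD Scl.
  + by move=> n; have [] := He n.
  + move=> x y; have := ccvg_mull c%:C%C (uL x y).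
    congr ccvg; apply/funext => n; have [_ ->] := He n; exact: cc.
  + by exists g => //; apply: op_funext => x y; rewrite gL cc.
- move=> _ x y [e /SD[_ [cp tn]] ->]; rewrite normrM nc mul1r.
  by rewrite rmorph_nat; exact: choi_bound.
- by move=> _ [e Se ->]; exact/herm/pch.
- exact/herm/cp_psd_choi.
- move=> _ [e Se ->] h; apply: (nS e Se); move: h; congr psd.
  by apply: op_funext => x y; rewrite /op_sub mulrBr.
exists N => //; exists d => // e Se.
have scaler (A : Op R (bas V * bas V)%type) :
    tr (op_mul N (fun x y => c%:C%C * A x y)) = c * tr (op_mul N A).
  by rewrite op_trace_mulC op_trace_scalel Re_real_mul op_trace_mulC.
by have := Nd _ (ex_intro2 _ _ e Se erefl); rewrite !scaler.
Qed.

Lemma op_ext_self (W : {fset nat}) (M : Op R (bas W)) : @op_ext R W W M = M.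
Proof.
apply: op_funext => x y; rewrite /op_ext !bres_id.
by case: forallP => // h; case: h => q; rewrite fsvalP.
Qed.

(* The maximally entangled state on [V] and a fresh copy of [V] turns a
   test of Choi matrices into a test of output states. *)
Lemma choi_test : exists2 W : {fset nat}, (V `<=` W)%fset &
  exists2 rho : Op R (bas W), pdensity rho &
  exists2 t : R, 0 < t & forall N : Op R (bas V * bas V)%type, effect N ->
  exists2 M : Op R (bas W), effect M & forall g, so_linear g ->
    tr (op_mul M (so_ext g rho)) = t * tr (op_mul N (choi g)).
Proof.
have [W VW [k bk]] := fresh_copy V; exists W => //.
pose h (p : bas V * bas V) : bas W := glue W V p.1 (k p.2).
have bh : bijective h.
  have bk2 : bijective (fun p : bas V * bas V => (p.1, k p.2)).
    have [k' kK k'K] := bk; exists (fun p => (p.1, k' p.2)) => -[a b] /=.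
      by rewrite kK.
    by rewrite k'K.
  exact: (bij_comp (bij_glue VW) bk2).
have [h' hK h'K] := bh; have bh' : bijective h' by exists h.
pose w (p : bas V * bas V) : C := if p.1 == p.2 then 1 else 0.
(* The squared norm of [w] is the dimension of H_V, so this factor gives the state trace one. *)
pose t : R := #|bas V|%:R^-1.
have n0 : (0 < #|bas V|)%N by apply/card_gt0P; exists (of_tot V (fun=> false)).
have t0 : 0 < t by rewrite invr_gt0 ltr0n.
exists (fun x y => t%:C%C * ket w (h' x) (h' y)).
  split.
    apply: psdZ; first by rewrite ler0c ltW.
    exact: (psd_comp_bij bh' (psd_ket w)).
  have -> : op_trace (fun x y => t%:C%C * ket w (h' x) (h' y)) =
      t%:C%C * op_trace (ket w).
    by rewrite -(op_trace_comp_bij (ket w) bh') /op_trace mulr_sumr.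
  have -> : op_trace (ket w) = #|bas V|%:R.
    rewrite /op_trace sum_pair -sum1_card natr_sum; apply: eq_bigr => v _.
    rewrite (bigD1 v)//= /ket /w /= eqxx conjC1 mulr1 big1 ?addr0// => v' vv'.
    by rewrite eq_sym (negbTE vv') mul0r.
  by rewrite /t fmorphV/= rmorph_nat mulVf// pnatr_eq0 -lt0n.
exists t => // N [pN lN].
exists (fun x y => N (h' x) (h' y)).
  split; first exact: (psd_comp_bij bh' pN).
  have := psd_comp_bij bh' lN; rewrite /lowner; congr psd; apply: op_funext => x y.
  by rewrite /op_sub /op_id (inj_eq (bij_inj bh')).
move=> g lg.
rewrite -(op_trace_mul_comp_bij _ _ bh).
have -> : (fun i j => N (h' (h i)) (h' (h j))) = N.
  by apply: op_funext => i j; rewrite !hK.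
set A := (X in complex.Re (op_trace (op_mul N X)) = _).
have -> : A = fun x y => t%:C%C * choi g x y.
  apply: op_funext => p q; rewrite /A.
  rewrite (so_ext_glue VW g _ (p.1, k p.2) (q.1, k q.2)) /so_ext_anc /=.
  have -> : (fun i j => t%:C%C * ket w (h' (glue W V i (k p.2)))
      (h' (glue W V j (k q.2)))) = fun i j => t%:C%C * matrix_unit R p.2 q.2 i j.
    apply: op_funext => i j.
    rewrite (hK (i, p.2)) (hK (j, q.2)) /ket /w /matrix_unit /=.
    by case: (j == q.2); rewrite ?conjC1 ?conjC0.
  by rewrite so_linearZ.
by rewrite op_trace_mulC op_trace_scalel Re_real_mul op_trace_mulC.
Qed.

Lemma effect_DProg_adjoint (W : {fset nat}) (e : SuperOp R (bas V)) (M : Op R (bas W)) :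
  (V `<=` W)%fset -> DProg e -> effect M -> effect (so_adjoint (so_ext e) M).
Proof.
move=> VW De; have [le [_ te]] := De; apply: effect_so_adjoint.
- exact: so_linear_ext.
- by move=> rho; exact: psd_DProg_ext.
- exact: trace_nonincreasing_ext.
Qed.

(* For [Psi = {M}] the weakest precondition of [E] is [{e^*(M) | e in E}]. *)
Lemma ref_T_le_S E F : NProg E -> F `<=` @DProg R V -> ref_T E F -> le_S E F.
Proof.
move=> NE FD EF f Ff; apply: contrapT => nf.
have [E0 [ED _]] := NE; have Df := FD _ Ff; have [lf _] := Df.
have [||N eN [d d0 Nd]] := @choi_separation E f 1 NE Df.
- by rewrite expr1n.
- move=> e Ee pe; apply: nf; exists e => //; apply/so_leP => //.
    by have [] := ED _ Ee.
  by move: pe; congr psd; apply: op_funext => x y; rewrite mul1r.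
have [W VW [rho drho [t t0 /(_ N eN)[M eM MN]]]] := choi_test.
have [prho _] := drho.
have := EF W [set so_adjoint (so_ext e) M | e in E] [set M].
move=> /(_ _ _ _ W _ rho drho) /wrap[].
- by move=> _ [e Ee <-]; exact: effect_DProg_adjoint (ED _ Ee) eM.
- by move=> _ ->.
- move=> X VWX sigma dsigma.
  have WX : (W `<=` X)%fset by move: VWX; rewrite fsubUset => /andP[].
  rewrite Exp_dem_image// /apply_set image_comp.
  (* Both infima range over [E] and agree term by term by duality. *)
  rewrite le_eqVlt; apply/orP; left; apply/eqP; congr inf; apply: eq_imagel => e Ee /=.
  by rewrite Exp_dem_set1 trace_so_adjoint_ext//; have [] := ED _ Ee.
- by rewrite fsubUset VW fsubset_refl.
rewrite Exp_dem_image// /apply_set image_comp => h.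
(* The precondition at [rho] is at least the left side by the gap; the run of [f] gives exactly the
   right side. *)
have : t * (tr (op_mul N (choi f)) + d) <= t * tr (op_mul N (choi f)).
  apply: le_trans (le_trans h _).
    apply: lb_le_inf; first by have [e Ee] := E0; eexists; exists e.
    move=> _ [e Ee <-]; have [le _] := ED _ Ee.
    rewrite trace_so_adjoint_ext// ?fsubset_refl// op_ext_self MN//.
    by rewrite ler_pM2l//; have := Nd e Ee; rewrite !mul1r.
  rewrite -MN// -{2}[M]op_ext_self -Exp_dem_set1; apply: ge_inf; last by exists f.
  exists 0 => _ [g Fg <-] /=; rewrite Exp_dem_set1; apply: effect_trace_ge0 => //.
  exact: psd_DProg_ext (FD _ Fg) prho.
by rewrite ler_pM2l//; lra.
Qed.

(* Dually, for [Psi = {1 - M}] it is [{1 - e^*(M) | e in E}]. *)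
Lemma ref_P_le_H E F : NProg E -> F `<=` @DProg R V -> ref_P E F -> le_H F E.
Proof.
move=> NE FD EF f Ff; apply: contrapT => nf.
have [E0 [ED _]] := NE; have Df := FD _ Ff; have [lf _] := Df.
have [||N eN [d d0 Nd]] := @choi_separation E f (-1) NE Df.
- by rewrite sqrrN expr1n.
- move=> e Ee pe; apply: nf; exists e => //; apply/so_leP => //.
    by have [] := ED _ Ee.
  move: pe; congr psd; apply: op_funext => x y.
  by rewrite rmorphN rmorph1 mulN1r opprB.
have [W VW [rho drho [t t0 /(_ N eN)[M eM MN]]]] := choi_test.
have [prho _] := drho.
have eM' := effect_sub_id eM.
pose cM := op_sub (@op_id R (bas W)) M.
have trc (X : {fset nat}) (sigma : Op R (bas X)) (A : Op R (bas W)) : (W `<=` X)%fset ->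
    tr (op_mul (op_ext (op_sub (@op_id R (bas W)) A)) sigma) =
    tr sigma - tr (op_mul (op_ext A) sigma).
  by move=> WX; rewrite op_ext_sub op_ext_id// op_trace_subl op_trace_id cReB.
have := EF W [set op_sub (@op_id R (bas W)) (so_adjoint (so_ext e) M) | e in E] [set cM].
move=> /(_ _ _ _ W _ rho drho) /wrap[].
- move=> _ [e Ee <-]; apply: effect_sub_id.
  exact: effect_DProg_adjoint (ED _ Ee) eM.
- by move=> _ ->.
- move=> X VWX sigma dsigma.
  have WX : (W `<=` X)%fset by move: VWX; rewrite fsubUset => /andP[].
  rewrite Exp_dem_image// /apply_set image_comp.
  rewrite le_eqVlt; apply/orP; left; apply/eqP; congr inf; apply: eq_imagel => e Ee /=.
  have [le _] := ED _ Ee.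
  by rewrite Exp_dem_set1 !trc// trace_so_adjoint_ext//; ring.
- by rewrite fsubUset VW fsubset_refl.
rewrite Exp_dem_image// /apply_set image_comp => h.
have WW : (W `<=` W)%fset by exact: fsubset_refl.
(* With sign -1 the gap puts every [e] at least [d] below [f] on [N]. In the partial value of [f]
   the lost trace cancels, leaving the right side. *)
have : tr rho - t * (tr (op_mul N (choi f)) - d) <= tr rho - t * tr (op_mul N (choi f)).
  apply: le_trans (le_trans h _).
    apply: lb_le_inf; first by have [e Ee] := E0; eexists; exists e.
    move=> _ [e Ee <-]; have [le _] := ED _ Ee.
    rewrite trc// trace_so_adjoint_ext// op_ext_self MN//.
    by rewrite lerD2l lerN2 ler_pM2l//; have := Nd e Ee; lra.
  have -> : tr rho - t * tr (op_mul N (choi f)) =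
     Exp_dem (so_ext f rho) [set cM] + tr rho - tr (so_ext f rho).
    by rewrite Exp_dem_set1 trc// op_ext_self MN//; ring.
  apply: ge_inf; last by exists f.
  exists 0 => _ [g Fg <-] /=; rewrite Exp_dem_set1.
  have pg := psd_DProg_ext VW (FD _ Fg) prho.
  have := effect_trace_ge0 WW eM' pg; have := trace_DProg_ext VW (FD _ Fg) prho.
  by rewrite -/cM; lra.
by rewrite lerD2l lerN2 ler_pM2l//; lra.
Qed.

Lemma le_S_upc E F : F `<=` @DProg R V -> le_S E F <-> upc F `<=` upc E.
Proof.
move=> FD; split=> [EF g [Dg [f Ff fg]]|FE f Ff].
  split=> //; have [e Ee ef] := EF _ Ff; exists e => //; exact: so_le_trans ef fg.
have [|_ //] := FE f.
by split; [exact: FD | exists f => //; exact: so_le_refl].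
Qed.

Lemma le_H_downc E F : F `<=` @DProg R V -> le_H F E <-> downc F `<=` downc E.
Proof.
move=> FD; split=> [FE g [Dg [f Ff gf]]|FE f Ff].
  split=> //; have [e Ee fe] := FE _ Ff; exists e => //; exact: so_le_trans gf fe.
have [|_ //] := FE f.
by split; [exact: FD | exists f => //; exact: so_le_refl].
Qed.

Lemma ref_T_iff E F : NProg E -> NProg F -> ref_T E F <-> le_S E F.
Proof.
move=> NE [F0 [FD _]]; split; first exact: ref_T_le_S.
by apply: le_S_ref_T => //; have [_ []] := NE.
Qed.

Lemma ref_P_iff E F : NProg E -> NProg F -> ref_P E F <-> le_H F E.
Proof.
move=> NE [F0 [FD _]]; split; first exact: ref_P_le_H.
by apply: le_H_ref_P => //; have [_ []] := NE.
Qed.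

Section TracePreserving.
Variables E F : set (SuperOp R (bas V)).
Hypotheses (ED : E `<=` @DProg R V) (FD : F `<=` @DProg R V).
Hypothesis Etp : forall e, E e -> trace_preserving e.
Hypothesis Ftp : forall f, F f -> trace_preserving f.

Lemma le_S_trace_preserving : le_S E F <-> F `<=` E.
Proof.
split=> [EF f Ff|FE f Ff]; last by exists f; [exact: FE | exact: so_le_refl].
have [e Ee ef] := EF _ Ff; rewrite -(so_le_trace_preserving_eq _ _ _ _ ef) //.
- by have [] := ED Ee.
- by have [] := FD Ff.
- exact: Etp.
- exact: Ftp.
Qed.

Lemma le_H_trace_preserving : le_H F E <-> F `<=` E.
Proof.
split=> [FE f Ff|FE f Ff]; last by exists f; [exact: FE | exact: so_le_refl].
have [e Ee fe] := FE _ Ff; rewrite (so_le_trace_preserving_eq _ _ _ _ fe) //.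
- by have [] := FD Ff.
- by have [] := ED Ee.
- exact: Ftp.
- exact: Etp.
Qed.

End TracePreserving.

End Refinement.

Theorem theorem5p1 (R : realType) (V : {fset nat})
  (E F : set (SuperOp R (bas V))) :
  NProg E -> NProg F ->
  (* (1) *)
  ((ref_T E F <-> le_S E F) /\ (le_S E F <-> upc F `<=` upc E)) /\
  (* (2) *)
  ((ref_P E F <-> le_H F E) /\ (le_H F E <-> downc F `<=` downc E)) /\
  (* (3) *)
  (le_EM E F <-> ref_T E F /\ ref_P F E) /\
  (* (4) *)
  ((equiv_T E F <-> upc E = upc F) /\ (equiv_P E F <-> downc E = downc F)) /\
  (* (5) *)
  ((forall e, E e -> trace_preserving e) -> (forall f, F f -> trace_preserving f) ->
     (ref_T E F <-> ref_P E F) /\ (ref_P E F <-> F `<=` E)).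
Proof.
move=> NE NF.
have [_ [ED _]] := NE; have [_ [FD _]] := NF.
have TEF := ref_T_iff NE NF; have TFE := ref_T_iff NF NE.
have PEF := ref_P_iff NE NF; have PFE := ref_P_iff NF NE.
have UEF := le_S_upc E FD; have UFE := le_S_upc F ED.
have DEF := le_H_downc E FD; have DFE := le_H_downc F ED.
split; first by [].
split; first by [].
split; first by rewrite /le_EM; tauto.
split.
  split.
    rewrite /equiv_T TEF TFE UEF UFE; split=> [[h1 h2]|->]; last by split.
    by rewrite eqEsubset.
  rewrite /equiv_P PEF PFE DEF DFE; split=> [[h1 h2]|->]; last by split.
  by rewrite eqEsubset.
move=> Etp Ftp.
have := le_S_trace_preserving ED FD Etp Ftp.
have := le_H_trace_preserving ED FD Etp Ftp.
tauto.
Qed.
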